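(* Consider the stochastic knapsack problem with random sizes described in the context. For any constants $\epsilon>0$ and $\gamma>0$, there is a polynomial time algorithm that computes a set $S\subseteq U$ of items such that the total profit $v(S)$ is at least $(1-\epsilon)$ times the optimum and $\Pr(w(S)\le1+\epsilon)\ge(1-\epsilon)\gamma$.
   Context: Stochastic knapsack with random sizes: a set $U$ of $n$ items is given; item $i$ has a random size $w_i\ge0$ (sizes mutually independent, with $\mathbb{E}[\phi^{w_i}]$ computable for complex $|\phi|\le1$) and a deterministic nonnegative integer profit $v_i$. A constant $0\le\gamma\le1$ is given. For $S\subseteq U$ write $w(S)=\sum_{i\in S}w_i$ and $v(S)=\sum_{i\in S}v_i$. The optimum is $\max\{v(S): S\subseteq U,\ \Pr(w(S)\le1)\ge\gamma\}$. *)

(* Defs.v *)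
From HB Require Import structures.
From mathcomp Require Import all_boot all_order all_algebra.
From mathcomp Require Import complex.
From mathcomp Require Import all_classical all_reals all_analysis.

Set Implicit Arguments.
Unset Strict Implicit.
Unset Printing Implicit Defensive.

Import Order.TTheory GRing.Theory Num.Theory.
Import numFieldNormedType.Exports.

Local Open Scope classical_set_scope.
Local Open Scope ring_scope.

(* Oracle RAM with logarithmic cost.  The memory consists of arrays of        *)
(* integers, numbered by nat and indexed by int; a scalar variable is a cell  *)
(* of some array.  Each operation is charged the bit lengths of the integers  *)
(* it handles, addresses included, so that running times agree with those of  *)
(* (oracle) Turing machines up to a polynomial.                               *)

Definition store := nat -> int -> int.

Definition upd (s : store) (a : nat) (j x : int) : store :=
  fun a' j' => if (a' == a) && (j' == j) then x else s a' j'.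

(* Length of the binary expansion of `|x|, with value 0 at x = 0. *)
Definition bitlen (x : int) : nat := up_log 2 `|x|%N.+1.

Variant binop := Add | Sub | Mul | Div | Leq.

(* Div is Euclidean division (remainder >= 0), with x / 0 = 0. *)
Definition binop_sem (o : binop) (x y : int) : int :=
  match o with
  | Add => x + y
  | Sub => x - y
  | Mul => x * y
  | Div => (x %/ y)%Z
  | Leq => Posz (x <= y)%R
  end.

Inductive expr :=
| Cst of int
| Get of nat & expr
| Bin of binop & expr & expr.

Fixpoint eval (s : store) (e : expr) : int :=
  match e with
  | Cst x => x
  | Get a e1 => s a (eval s e1)
  | Bin o e1 e2 => binop_sem o (eval s e1) (eval s e2)
  end.

Fixpoint eval_cost (s : store) (e : expr) : nat :=
  (match e with
   | Cst _ => 1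
   | Get _ e1 => (eval_cost s e1).+1
   | Bin _ e1 e2 => (eval_cost s e1 + eval_cost s e2).+1
   end + bitlen (eval s e))%N.

(* O i x y d k is the pair of numerators (p, q) of a dyadic approximation     *)
(* (p + q i) / 2 ^ k, with k bits of precision, of E[phi ^ w_i], where        *)
(* phi = (x + y i) / d; see answers below.                                    *)
Definition oracle := nat -> int -> int -> nat -> nat -> int * int.

Inductive cmd :=
| Skip
| Assign of nat & expr & expr
| Seq of cmd & cmd
| If of expr & cmd & cmd
| While of expr & cmd
| Query of nat & expr & expr & expr & expr & expr.

(* exec O c s s' t: started in s, and with O as oracle, the command c halts   *)
(* in s' after time t.  A query leaves its two answers in cells 0 and 1 of    *)
(* its array.  It is charged linearly in the precision k itself, and not in   *)
(* the length of k: reading k bits takes time k.                              *)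
Inductive exec (O : oracle) : cmd -> store -> store -> nat -> Prop :=
| ExecSkip s :
    exec O Skip s s 1
| ExecAssign a e1 e2 s :
    exec O (Assign a e1 e2) s (upd s a (eval s e1) (eval s e2))
      (eval_cost s e1 + eval_cost s e2).+1
| ExecSeq c1 c2 s1 s2 s3 t1 t2 :
    exec O c1 s1 s2 t1 -> exec O c2 s2 s3 t2 ->
    exec O (Seq c1 c2) s1 s3 (t1 + t2).+1
| ExecIf e c1 c2 s s' t :
    exec O (if eval s e != 0 then c1 else c2) s s' t ->
    exec O (If e c1 c2) s s' (eval_cost s e + t).+1
| ExecWhileEnd e c s :
    eval s e = 0 ->
    exec O (While e c) s s (eval_cost s e).+1
| ExecWhileStep e c s1 s2 s3 t1 t2 :
    eval s1 e != 0 ->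
    exec O c s1 s2 t1 -> exec O (While e c) s2 s3 t2 ->
    exec O (While e c) s1 s3 (eval_cost s1 e + t1 + t2).+1
| ExecQuery a ei ex ey ed ek s p q :
    O `|eval s ei|%N (eval s ex) (eval s ey) `|eval s ed|%N `|eval s ek|%N
      = (p, q) ->
    exec O (Query a ei ex ey ed ek) s (upd (upd s a 0 p) a 1 q)
      (eval_cost s ei + eval_cost s ex + eval_cost s ey + eval_cost s ed
       + eval_cost s ek + `|eval s ek| + bitlen p + bitlen q).+1.

Lemma exec_det O c s s1 s2 t1 t2 :
  exec O c s s1 t1 -> exec O c s s2 t2 -> s1 = s2 /\ t1 = t2.
Proof.
move=> h; elim: h s2 t2 => {c s s1 t1}.
- by move=> s s2 t2 h; inversion h.
- by move=> a e1 e2 s s2 t2 h; inversion h.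
- move=> c1 c2 s1 s2 s3 t1 t2 _ IH1 _ IH2 s' t' h.
  inversion h as [| |? ? ? ? ? ? ? h1 h2| | | |]; subst.
  by have [? ?] := IH1 _ _ h1; subst; have [-> ->] := IH2 _ _ h2.
- move=> e c1 c2 s s' t _ IH s2 t2 h.
  inversion h as [| | |? ? ? ? ? ? h1| | |]; subst.
  by have [-> ->] := IH _ _ h1.
- move=> e c s e0 s2 t2 h.
  inversion h as [| | | | |? ? ? ? ? ? ? e1|]; subst => //.
  by move: e1; rewrite e0.
- move=> e c s1 s2 s3 t1 t2 e0 _ IH1 _ IH2 s' t' h.
  inversion h as [| | | |? ? ? e1|? ? ? ? ? ? ? _ h1 h2|]; subst.
    by move: e0; rewrite e1.
  by have [? ?] := IH1 _ _ h1; subst; have [-> ->] := IH2 _ _ h2.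
- move=> a ei ex ey ed ek s p q Opq s2 t2 h.
  inversion h as [| | | | | |? ? ? ? ? ? ? ? ? Opq']; subst.
  by move: Opq'; rewrite Opq => -[-> ->].
Qed.

(* Cell 0 of array 0 holds n, cells 0, ..., n - 1 of array 1 hold the         *)
(* profits, and all other cells hold 0.                                       *)
Definition input (n : nat) (v : 'I_n -> nat) : store := fun a j =>
  match a, j with
  | 0%N, Posz 0%N => n%:Z
  | 1%N, Posz k => if insub k is Some i then (v i)%:Z else 0
  | _, _ => 0
  end.

Definition input_size (n : nat) (v : 'I_n -> nat) : nat :=
  (n + \sum_(i < n) bitlen (v i)%:Z)%N.

(* The set of items is output as its indicator vector, in array 2. *)
Definition output (n : nat) (s : store) : {set 'I_n} :=
  [set i : 'I_n | s 2%N (i : nat)%:Z != 0]%SET.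

Section ComplexPower.
Variable R : realType.
Implicit Type z : R[i].

(* Principal argument, in ]-pi, pi] (z <> 0). *)
Definition carg z : R :=
  let: Complex a b := z in
  if b < 0 then - acos (a / Normc.normc z) else acos (a / Normc.normc z).

(* z ^ x = exp (x Log z) for the principal logarithm, extended by 0 ^ 0 = 1   *)
(* and 0 ^ x = 0 for x <> 0 (as powR does).                                   *)
Definition cpow z (x : R) : R[i] :=
  Complex (powR (Normc.normc z) x * cos (x * carg z))
          (powR (Normc.normc z) x * sin (x * carg z)).

End ComplexPower.

Section StochasticKnapsack.
Context {d : measure_display} {T : measurableType d} {R : realType}.
Variables (P : probability T R) (n : nat).
Implicit Types (w : 'I_n -> {RV P >-> R}) (v : 'I_n -> nat) (S : {set 'I_n}).

Definition mutually_independent w : Prop :=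
  forall (J : {set 'I_n}) (A : 'I_n -> set R),
    (forall i, measurable (A i)) ->
    P (\bigcap_(i in [set` J]) (w i @^-1` A i))
      = (\prod_(i in J) P (w i @^-1` A i))%E.

(* E[X] for complex X, componentwise. *)
Definition cexpectation (X : T -> R[i]) : R[i] :=
  Complex (fine 'E_P[fun t => complex.Re (X t)])
          (fine 'E_P[fun t => complex.Im (X t)]).

(* Access to the size distributions: E[phi ^ w_i] can be computed to any      *)
(* precision 2 ^ - k, for every phi in Q[i] with |phi| <= 1.                  *)
Definition answers w (O : oracle) : Prop :=
  forall (i : 'I_n) (x y : int) (den k : nat), (0 < den)%N ->
    let phi : R[i] := Complex (x%:~R / den%:R) (y%:~R / den%:R) in
    Normc.normc phi <= 1 ->
    let: (p, q) := O i x y den k in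
    Normc.normc (Complex (p%:~R / 2 ^+ k) (q%:~R / 2 ^+ k)
          - cexpectation (fun t => cpow phi (w i t))) <= 2 ^- k.

Definition size_of w S (t : T) : R := \sum_(i in S) w i t.

Definition profit v S : nat := (\sum_(i in S) v i)%N.

Definition prob_fits w S (c : R) : \bar R := P [set t | size_of w S t <= c].

Definition optimum v w (gamma : R) : nat :=
  (\max_(S : {set 'I_n} | (gamma%:E <= prob_fits w S 1)%E) profit v S)%N.

End StochasticKnapsack.

(* Main.v *)
(** Only real bases are queried.  For D large and N about D / delta, the
    polynomial q(y) = 1 - (1 - y)^N at y = D^-x is at least 1 - delta for
    x <= 1 and at most delta for x > 1 + eps, so that E[q(D^-w(S))] stands
    between Pr(w(S) <= 1) - delta and Pr(w(S) <= 1 + eps) + delta.  By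
    independence E[q(D^-w(S))] is a fixed linear combination of N products
    \prod_(i in S) E[D^-(j w_i)] of numbers in [0, 1].  A dynamic program runs
    through the items and keeps these N products rounded down to multiples of
    1 / M, with M linear in n: multiplying by numbers in [0, 1] does not amplify
    errors, so the rounding errors add up to n / M only, and there are (M + 1)^N
    states.  For each state it stores a most profitable set, with exact profits;
    the output is the best set among the states whose combination exceeds a
    threshold, and its profit is even at least the optimum. *)

Require Import Defs.
From mathcomp Require Import all_boot all_order all_algebra.
From mathcomp Require Import complex.
From mathcomp Require Import all_classical all_reals all_analysis.
From mathcomp Require Import measurable_realfun zify ring lra.

Set Implicit Arguments.
Unset Strict Implicit.
Unset Printing Implicit Defensive.

Import Order.TTheory GRing.Theory Num.Theory.

Local Open Scope ring_scope.

Local Notation eval := Defs.eval.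

(** * Running times *)

(** The coefficients of q are signed binomial coefficients, so an error on the products is
    multiplied by the sum of their absolute values, which is exponential in N. This is harmless
    because q depends on eps and gamma only: D, N and that sum are constants, the program has them
    in its text, and (M + 1)^N is polynomial in n. The real parameters enter the program through
    integer constants alone.

    The separation comes from (1 - y)^N >= 1 - N y and (1 - y)^N <= 1 / (N y): q is near 0 where N y
    is small and near 1 where N y is large. Between sizes 1 and 1 + eps the value y drops by the
    factor D^eps, which a large D makes as big as desired.

    A state describes the distribution of the size only. Profits are contents of the table and never
    indices, so they need no scaling, and a set travels with its profit inside a single integer. *)

Section PolynomialBounds.
Local Open Scope nat_scope.

(** For [x > 0] a power of [x] grows with its exponent, so that even the exponents of a sum of two
    bounds can simply be added. *)
Definition poly_bounded (f : nat -> nat) : Prop :=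
  exists C K, forall x, 0 < x -> f x <= C * x ^ K.

Lemma poly_bounded_cst c : poly_bounded (fun=> c).
Proof. by exists c, 0 => x _; rewrite expn0 muln1. Qed.

Lemma poly_bounded_id : poly_bounded id.
Proof. by exists 1, 1 => x _; rewrite expn1 mul1n. Qed.

Lemma poly_boundedD f g :
  poly_bounded f -> poly_bounded g -> poly_bounded (fun x => f x + g x).
Proof.
move=> [C [K fK]] [C' [K' gK]]; exists (C + C'), (K + K') => x x0.
rewrite mulnDl leq_add //.
  by rewrite (leq_trans (fK x x0))// leq_mul// leq_pexp2l// leq_addr.
by rewrite (leq_trans (gK x x0))// leq_mul// leq_pexp2l// leq_addl.
Qed.

Lemma poly_boundedM f g :
  poly_bounded f -> poly_bounded g -> poly_bounded (fun x => f x * g x).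
Proof.
move=> [C [K fK]] [C' [K' gK]]; exists (C * C'), (K + K') => x x0.
by rewrite expnD mulnACA leq_mul ?fK ?gK.
Qed.

Lemma poly_boundedX f k :
  poly_bounded f -> poly_bounded (fun x => f x ^ k).
Proof.
move=> fP; elim: k => [|k IH].
  exact: poly_bounded_cst.
have [C [K gK]] := poly_boundedM fP IH.
by exists C, K => x x0; rewrite expnS gK.
Qed.

Lemma poly_boundedS f : poly_bounded f -> poly_bounded (fun x => (f x).+1).
Proof.
move=> fP; have [C [K gK]] := poly_boundedD (poly_bounded_cst 1) fP.
by exists C, K.
Qed.

End PolynomialBounds.

(** * Bit lengths and syntactic cost bounds *)

Section TimeBounds.
Local Open Scope nat_scope.

Lemma bitlen_le L x : (bitlen x <= L) = (`|x|%N < 2 ^ L).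
Proof.
apply/idP/idP; rewrite /bitlen => h; last exact: up_log_min.
by apply: (leq_trans (up_logP `|x|.+1 (ltnSn 1))); rewrite leq_exp2l.
Qed.

Definition bits_le (L : nat) (s : store) : Prop :=
  forall a j, bitlen (s a j) <= L.

Fixpoint esize (e : expr) : nat :=
  match e with
  | Cst x => (bitlen x).+1
  | Get _ e1 => (esize e1).+1
  | Bin _ e1 e2 => (esize e1 + esize e2).+1
  end.

(** The length of a result exceeds the total length of the operands by at most 1, so every value met
    in [e] has at most [esize e * L] bits; and [e] has at most [esize e] nodes. *)
Definition ebound (L : nat) (e : expr) : nat := esize e * (esize e * L).+1.

(* [m] bounds the number of iterations of every loop, and [L] both the bit
   lengths of all cells and the precisions of the queries. *)
Fixpoint cbound (L m : nat) (c : cmd) : nat :=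
  match c with
  | Skip => 1
  | Assign _ e1 e2 => (ebound L e1 + ebound L e2).+1
  | Seq c1 c2 => (cbound L m c1 + cbound L m c2).+1
  | If e c1 c2 => (ebound L e + (cbound L m c1 + cbound L m c2)).+1
  | While e c => m.+1 * (ebound L e + cbound L m c).+1
  | Query _ ei ex ey ed ek =>
      (ebound L ei + ebound L ex + ebound L ey + ebound L ed + ebound L ek
       + 3 * L).+1
  end.

Lemma absz_divz_le (x y : int) : `|(x %/ y)%Z|%N <= `|x|%N.
Proof.
case: (eqVneq y 0) => [->|y0]; first by rewrite divz0.
have := divz_eq x y; have := modz_ge0 x y0.
have := ltz_mod x y0.
set q := (x %/ y)%Z; set r := (x %% y)%Z; move=> rlt r0 xE.
nia.
Qed.

Lemma bitlen_binop o (x y : int) :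
  bitlen (binop_sem o x y) <= (bitlen x + bitlen y).+1.
Proof.
rewrite bitlen_le.
have hx : `|x|%N < 2 ^ bitlen x by rewrite -bitlen_le.
have hy : `|y|%N < 2 ^ bitlen y by rewrite -bitlen_le.
rewrite expnS expnD.
set a := 2 ^ bitlen x in hx *; set b := 2 ^ bitlen y in hy *.
case: o => /=.
- nia.
- nia.
- rewrite abszM; nia.
- have := absz_divz_le x y; nia.
- case: (x <= y)%R => /=; nia.
Qed.

Lemma bitlen_eval L s e :
  0 < L -> bits_le L s -> bitlen (eval s e) <= esize e * L.
Proof.
move=> L0 sL; elim: e => [x|a e IH|o e1 IH1 e2 IH2] /=.
- by nia.
- by rewrite (leq_trans (sL _ _))// leq_pmull.
- have := bitlen_binop o (eval s e1) (eval s e2); nia.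
Qed.

Lemma eval_cost_le L s e :
  0 < L -> bits_le L s -> eval_cost s e <= ebound L e.
Proof.
move=> L0 sL; elim: e => [x|a e IH|o e1 IH1 e2 IH2].
- by rewrite /ebound /=; nia.
- have := bitlen_eval (Get a e) L0 sL; move: IH; rewrite /ebound /=; nia.
- have := bitlen_eval (Bin o e1 e2) L0 sL; move: IH1 IH2; rewrite /ebound /=.
  nia.
Qed.

Lemma poly_bounded_ebound (L : nat -> nat) e :
  poly_bounded L -> poly_bounded (fun x => ebound (L x) e).
Proof.
move=> LP; apply: poly_boundedM; first exact: poly_bounded_cst.
by apply: poly_boundedS; apply: poly_boundedM; first exact: poly_bounded_cst.
Qed.

Lemma poly_bounded_cbound (L m : nat -> nat) c :
  poly_bounded L -> poly_bounded m ->
  poly_bounded (fun x => cbound (L x) (m x) c).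
Proof.
move=> LP mP; have eP := poly_bounded_ebound _ LP.
elim: c => [|a e1 e2|c1 IH1 c2 IH2|e c1 IH1 c2 IH2|e c IH|a e1 e2 e3 e4 e5] /=.
- exact: poly_bounded_cst.
- by apply: poly_boundedS; apply: poly_boundedD.
- by apply: poly_boundedS; apply: poly_boundedD.
- by apply: poly_boundedS; apply: poly_boundedD => //; apply: poly_boundedD.
- have := poly_boundedM (poly_boundedS mP) (poly_boundedS (poly_boundedD (eP e) IH)).
  exact.
- apply/poly_boundedS/poly_boundedD; first by do !apply: poly_boundedD.
  by apply: poly_boundedM => //; exact: poly_bounded_cst.
Qed.

End TimeBounds.

(** * Total correctness with running times *)

Section TimedTriples.
Local Open Scope nat_scope.
Variables (O : oracle) (L m : nat).
Hypothesis L_gt0 : 0 < L.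

(** The time bound depends on the syntax of [c] alone, so triples compose without any arithmetic on
    times. Since [bits_le] is carried along, an assignment only has to bound its own new value. *)
Definition triple (Pre : store -> Prop) (c : cmd) (Post : store -> Prop) :=
  forall s, bits_le L s -> Pre s ->
  exists s' t, [/\ exec O c s s' t, t <= cbound L m c, bits_le L s' & Post s'].

Lemma bits_le_upd s a j x :
  bits_le L s -> bitlen x <= L -> bits_le L (upd s a j x).
Proof. by move=> sL xL a' j'; rewrite /upd; case: ifP. Qed.

Lemma triple_conseq (Pre Pre' Post Post' : store -> Prop) c :
  (forall s, Pre' s -> Pre s) -> (forall s, Post s -> Post' s) ->
  triple Pre c Post -> triple Pre' c Post'.
Proof.
move=> pre post h s sL /pre Ps.
by have [s' [t [? ? ? /post ?]]] := h s sL Ps; exists s', t.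
Qed.

Lemma triple_exists (I : Type) (Pre : I -> store -> Prop) c Post :
  (forall i, triple (Pre i) c Post) -> triple (fun s => exists i, Pre i s) c Post.
Proof. by move=> h s sL [i Pi]; exact: (h i). Qed.

Lemma triple_skip (Pre Post : store -> Prop) :
  (forall s, bits_le L s -> Pre s -> Post s) -> triple Pre Skip Post.
Proof. by move=> h s sL /(h s sL) ?; exists s, 1; split => //; exact: ExecSkip. Qed.

Lemma triple_assign (Pre Post : store -> Prop) a e1 e2 :
  (forall s, bits_le L s -> Pre s -> bitlen (eval s e2) <= L /\
    Post (upd s a (eval s e1) (eval s e2))) ->
  triple Pre (Assign a e1 e2) Post.
Proof.
move=> h s sL /(h s sL)[e2L post]; eexists _, _.
split; [exact: ExecAssign| | |exact: post].
- by rewrite /= ltnS leq_add ?eval_cost_le.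
- exact: bits_le_upd.
Qed.

Lemma triple_seq (Mid Pre Post : store -> Prop) c1 c2 :
  triple Pre c1 Mid -> triple Mid c2 Post -> triple Pre (Seq c1 c2) Post.
Proof.
move=> h1 h2 s sL /(h1 s sL)[s1 [t1 [x1 b1 sL1 /(h2 s1 sL1)]]].
move=> [s2 [t2 [x2 b2 sL2 post]]].
exists s2, (t1 + t2).+1; split => //; first exact: ExecSeq x1 x2.
by rewrite /= ltnS leq_add.
Qed.

Lemma triple_if (Pre Post : store -> Prop) e c1 c2 :
  triple (fun s => Pre s /\ eval s e != 0%R) c1 Post ->
  triple (fun s => Pre s /\ eval s e = 0%R) c2 Post ->
  triple Pre (If e c1 c2) Post.
Proof.
move=> h1 h2 s sL pre; have eL := eval_cost_le e L_gt0 sL.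
have [e0|e0] := boolP (eval s e != 0%R).
  have [s' [t [x b sL' post]]] := h1 s sL (conj pre e0).
  exists s', (eval_cost s e + t).+1; split => //.
    by apply: ExecIf; rewrite e0.
  by rewrite /= ltnS leq_add// (leq_trans b) ?leq_addr.
have [s' [t [x b sL' post]]] := h2 s sL (conj pre (eqP (negbNE e0))).
exists s', (eval_cost s e + t).+1; split => //.
  by apply: ExecIf; rewrite (negbTE e0).
by rewrite /= ltnS leq_add// (leq_trans b) ?leq_addl.
Qed.

Lemma triple_query (Pre Post : store -> Prop) a ei ex ey ed ek :
  (forall s, Pre s ->
    let: (p, q) := O `|eval s ei|%N (eval s ex) (eval s ey) `|eval s ed|%N
                     `|eval s ek|%N in
    [/\ `|eval s ek|%N <= L, bitlen p <= L, bitlen q <= L &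
        Post (upd (upd s a 0%R p) a 1%R q)]) ->
  triple Pre (Query a ei ex ey ed ek) Post.
Proof.
move=> h s sL /h; case E : (O _ _ _ _ _) => [p q] [kL pL qL post].
eexists _, _; split; [exact: ExecQuery E| | |exact: post].
- have c e := eval_cost_le e L_gt0 sL.
  have := (c ei, c ex, c ey, c ed, c ek) => -[[[[]]]]; rewrite [cbound _ _ _]/=.
  lia.
- by do !apply: bits_le_upd.
Qed.

(* The counter of a loop is cell 0 of array x. *)
Definition var (x : nat) : expr := Get x (Cst 0).

Definition For (x : nat) (bound : expr) (body : cmd) : cmd :=
  Seq (Assign x (Cst 0) (Cst 0))
      (While (Bin Leq (Bin Add (var x) (Cst 1)) bound)
             (Seq body (Assign x (Cst 0) (Bin Add (var x) (Cst 1))))).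

(** The loop itself increments the counter, so [J] has to ignore it and the body has to leave it as
    found. The bound is evaluated again at each test, so it must keep the value [N] under every
    [J k]. *)
Lemma triple_for (J : nat -> store -> Prop) N x bound body :
  N <= m -> N < 2 ^ L ->
  (forall k s, J k s -> eval s bound = N%:Z) ->
  (forall k s z, J k s -> J k (upd s x 0%R z)) ->
  (forall k, k < N -> triple (fun s => J k s /\ s x 0%R = k%:Z) body
                             (fun s => J k.+1 s /\ s x 0%R = k%:Z)) ->
  triple (J 0) (For x bound body) (J N).
Proof.
move=> Nm NL boundE JX bodyP.
pose cond := Bin Leq (Bin Add (var x) (Cst 1)) bound.
pose body' := Seq body (Assign x (Cst 0) (Bin Add (var x) (Cst 1))).
(* Here [k] is the number of rounds left: [k.+1] tests and [k] executions of the body. *)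
have loop k s : k <= N -> bits_le L s -> J (N - k) s -> s x 0%R = (N - k)%:Z ->
    exists s' t, [/\ exec O (While cond body') s s' t,
      t <= k.+1 * (ebound L cond + cbound L m body').+1, bits_le L s' & J N s'].
  elim: k s => [|k IH] s kN sL Js sx.
    rewrite subn0 in Js sx.
    exists s, (eval_cost s cond).+1; split => //.
      by apply: ExecWhileEnd; rewrite /= sx (boundE _ _ Js) -PoszD lez_nat; lia.
    by have := eval_cost_le cond L_gt0 sL; lia.
  have lt : N - k.+1 < N by lia.
  have bodyP' : triple (fun s => J (N - k.+1) s /\ s x 0%R = (N - k.+1)%:Z) body'
      (fun s => J (N - k) s /\ s x 0%R = (N - k)%:Z).
    apply: (triple_seq (bodyP _ lt)); apply: triple_assign => s1 _ [J1 sx1] /=.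
    have -> : (s1 x 0 + 1 = (N - k)%:Z)%R by rewrite sx1; lia.
    split; first by rewrite bitlen_le; lia.
    split; last by rewrite /upd !eqxx.
    by rewrite -(subnSK kN); exact: JX.
  have [s1 [t1 [x1 b1 sL1 [Js1 sx1]]]] := bodyP' s sL (conj Js sx).
  have [s2 [t2 [x2 b2 sL2 Js2]]] := IH s1 (ltnW kN) sL1 Js1 sx1.
  exists s2, (eval_cost s cond + t1 + t2).+1; split => //.
    apply: (ExecWhileStep _ x1 x2).
    by rewrite /= sx (boundE _ _ Js) -PoszD lez_nat; lia.
  by have := eval_cost_le cond L_gt0 sL; lia.
apply: (@triple_seq (fun s => J 0 s /\ s x 0%R = 0%R)).
  apply: triple_assign => s _ Js; split; first by rewrite bitlen_le expn_gt0.
  by split; [exact: JX|rewrite /upd !eqxx].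
move=> s sL [Js sx].
have [] := loop N s (leqnn N) sL; rewrite ?subnn// => s' [t [? tb ? ?]].
exists s', t; split => //; apply: (leq_trans tb).
by rewrite [cbound _ _ _]/= leq_mul.
Qed.

Definition maximize (a : nat) (e1 e2 : expr) : cmd :=
  If (Bin Leq (Get a e1) e2) (Assign a e1 e2) Skip.

Lemma triple_maximize (Pre Post : store -> Prop) a e1 e2 :
  (forall s, bits_le L s -> Pre s -> bitlen (eval s e2) <= L /\
    Post (upd s a (eval s e1) (Num.max (s a (eval s e1)) (eval s e2)))) ->
  triple Pre (maximize a e1 e2) Post.
Proof.
move=> h; apply: triple_if.
  by apply: triple_assign => s sL [/(h s sL)[? post] /=]; move: post; case: leP.
apply: triple_skip => s sL [/(h s sL)[_ post] /=]; move: post; case: leP => // _.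
rewrite (_ : upd _ _ _ _ = s)//.
apply/funext => a'; apply/funext => j'; rewrite /upd.
by case: ifP => // /andP[/eqP -> /eqP ->].
Qed.

End TimedTriples.

(** * The dynamic program *)

Section Codes.
Local Open Scope nat_scope.
Implicit Types (B c j k : nat) (f : nat -> nat).

Definition digit B c j : nat := (c %/ B ^ j) %% B.

Fixpoint code B f k : nat :=
  if k is k'.+1 then f 0 + B * code B (fun j => f j.+1) k' else 0.

Lemma code_lt B f k :
  (forall j, j < k -> f j < B) -> code B f k < B ^ k.
Proof.
elim: k f => [//|k IH] f fB /=.
have h0 : f 0 < B by exact: fB.
have h1 : code B (fun j => f j.+1) k < B ^ k by apply: IH => j jk; exact: fB.
rewrite expnS; nia.
Qed.

Lemma digit_code B f k j :
  (forall j, j < k -> f j < B) -> j < k -> digit B (code B f k) j = f j.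
Proof.
elim: k f j => [//|k IH] f j fB jk /=.
have h0 : f 0 < B by exact: fB.
rewrite /digit; case: j jk => [_|j jk].
  by rewrite expn0 divn1 addnC (mulnC B) modnMDl modn_small.
rewrite expnS divnMA addnC (mulnC B) divnMDl ?(leq_ltn_trans (leq0n _) h0)//.
rewrite (divn_small h0) addn0.
by rewrite -[LHS]/(digit B (code B (fun j => f j.+1) k) j) IH// => i ik; exact: fB.
Qed.

End Codes.

(* A subset of the first [i] items is given by its decisions
   [b 0, ..., b (i - 1)]. *)
Section Decisions.
Local Open Scope nat_scope.
Variables (step : nat -> nat -> nat) (c0 : nat) (v : nat -> nat).
Implicit Types (b : nat -> bool) (i : nat).

Fixpoint state b i : nat :=
  if i is i'.+1 then
    if b i' then step i' (state b i') else state b i'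
  else c0.

Definition value b i : nat := \sum_(j < i) b j * v j.

(* The profit, up to the factor [2 ^ i], followed by the [i] decisions as bits:
   comparing records of the same length compares profits first. *)
Fixpoint record b i : nat :=
  if i is i'.+1 then 2 * record b i' + b i' * (2 ^ i * v i' + 1) else 1.

Lemma eq_state b b' i :
  (forall j, j < i -> b j = b' j) -> state b i = state b' i.
Proof.
elim: i => //= i IH h; rewrite h// IH// => j ji; apply: h; exact: ltnW.
Qed.

Lemma eq_record b b' i :
  (forall j, j < i -> b j = b' j) -> record b i = record b' i.
Proof.
elim: i => //= i IH h; rewrite h// IH// => j ji; apply: h; exact: ltnW.
Qed.

(** The decision bits form a number below [2 ^ i], so they never carry into the profit; the extra 1
    is the initial value of [record]. *)
Lemma record_bounds b i :
  2 ^ i * (1 + value b i) <= record b i < 2 ^ i * (2 + value b i).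
Proof.
elim: i => [|i /andP[IH1 IH2]]; first by rewrite /value big_ord0.
rewrite [record _ _]/= /value big_ord_recr/= -/(value b i) expnS.
set z := 2 ^ i in IH1 IH2 *.
by case: (b i); rewrite ?mul1n ?mul0n; nia.
Qed.

(** A record starts from 1 for this reason: 0 is left to mark the table cells that no set
    reaches. *)
Lemma record_gt0 b i : 0 < record b i.
Proof. by elim: i => //= i IH; rewrite addn_gt0 muln_gt0 IH. Qed.

Lemma record_le_value b b' i : record b i <= record b' i -> value b i <= value b' i.
Proof.
have /andP[h _] := record_bounds b i; have /andP[_ h'] := record_bounds b' i.
move=> le; have := leq_ltn_trans (leq_trans h le) h'.
by rewrite ltn_pmul2l ?expn_gt0// !ltnS add1n ltnS.
Qed.

Lemma record_lt b i V :
  (forall j, j < i -> v j <= V) -> record b i < 2 ^ i * (2 + i * V).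
Proof.
move=> vV; have /andP[_ h] := record_bounds b i; apply: (leq_trans h).
rewrite leq_mul// leq_add2l /value.
have -> : i * V = \sum_(j < i) V by rewrite sum_nat_const card_ord.
by apply: leq_sum => j _; case: (b j); rewrite ?mul1n ?mul0n ?vV.
Qed.

End Decisions.

(** * The program and its loop invariants *)

Section Program.
Local Open Scope nat_scope.
Variables (N A D k0 : nat) (cf : nat -> int) (thr : int).

Definition baseE : expr :=
  Bin Add (Bin Mul (Cst A%:Z) (Bin Add (var 0) (Cst 1))) (Cst 1).
Definition powE e k : expr := iter k (Bin Mul e) (Cst 1).
Definition widthE : expr := powE baseE N.

Fixpoint codeE (f : nat -> expr) k : expr :=
  if k is k'.+1 then Bin Add (f 0) (Bin Mul baseE (codeE (fun j => f j.+1) k'))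
  else Cst 0.

Definition digitE j : expr :=
  let q := Bin Div (var 6) (powE baseE j) in
  Bin Defs.Sub q (Bin Mul (Bin Div q baseE) baseE).

Definition stepE : expr :=
  codeE (fun j =>
    Bin Div (Bin Mul (digitE j) (Bin Add (var (8 + j)) (Cst 1)))
            (Bin Add (Bin Mul (Cst (2 ^ k0)%:Z) (var 4)) (Cst 2))) N.

Fixpoint scoreE k : expr :=
  if k is k'.+1 then Bin Add (scoreE k') (Bin Mul (Cst (cf k')) (digitE k'))
  else Cst 0.

Definition addrE r c : expr := Bin Add (Bin Mul r widthE) c.

(** The base [1 / D ^ (k + 1)] yields the moment of order [k + 1] of [D ^ - w_i]. As [N] and [D] are
    constants, the queries are unrolled, and so are the digits of a state. *)
Fixpoint queries k : cmd :=
  if k is k'.+1 then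
    Seq (queries k')
        (Query (8 + k') (var 5) (Cst 1) (Cst 0) (Cst (D ^ k'.+1)%:Z)
               (Bin Add (Cst k0%:Z) (var 5)))
  else Skip.

(** Different states of a row may move to the same cell of the next row, hence [maximize] for both
    decisions. The row being read is not modified, so [twice] has the same value in both updates. *)
Definition extend : cmd :=
  let next := Bin Add (var 5) (Cst 1) in
  let twice := Bin Mul (Cst 2) (Get 3 (addrE (var 5) (var 6))) in
  If (Get 3 (addrE (var 5) (var 6)))
     (Seq (maximize 3 (addrE next stepE)
             (Bin Add twice
                (Bin Add (Bin Mul (Bin Mul (Cst 2) (var 4)) (Get 1 (var 5)))
                   (Cst 1))))
          (maximize 3 (addrE next (var 6)) twice))
     Skip.

Definition select : cmd :=
  If (Bin Leq (Bin Mul (Cst thr) (Bin Add (var 0) (Cst 1))) (scoreE N))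
     (maximize 7 (Cst 0) (Get 3 (addrE (var 0) (var 6))))
     Skip.

(** The latest decision is the lowest bit, so the items come out in decreasing order. *)
Definition decode : cmd :=
  Seq (Assign 2 (Bin Defs.Sub (Bin Defs.Sub (var 0) (Cst 1)) (var 5))
         (Bin Defs.Sub (var 7) (Bin Mul (Bin Div (var 7) (Cst 2)) (Cst 2))))
      (Assign 7 (Cst 0) (Bin Div (var 7) (Cst 2))).

(* Arrays: 3 = table of the dynamic program, row [i] starting at [i * W];
   4 = [2 ^ i]; 5 = item [i]; 6 = state [c]; 7 = best record;
   8 + j = answer to query [j]. *)
Definition knapsack : cmd :=
  Seq (Assign 4 (Cst 0) (Cst 1))
 (Seq (Assign 3 (codeE (fun=> Bin Defs.Sub baseE (Cst 1)) N) (Cst 1))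
 (Seq (For 5 (var 0)
        (Seq (queries N)
        (Seq (For 6 widthE extend)
             (Assign 4 (Cst 0) (Bin Mul (Cst 2) (var 4))))))
 (Seq (Assign 7 (Cst 0) (Cst 0))
 (Seq (For 6 widthE select)
      (For 5 (var 0) decode))))).

Variables (O : oracle) (n : nat).

Let B := A * n.+1 + 1.
Let W := B ^ N.
Let prec i := k0 + i.
Definition answer i j : int * int := O i 1 0 (D ^ j.+1) (prec i).
(* [(p + 1) / (2 ^ k + 2)] is in [0, 1] for every admissible answer [p], so the
   digits of a state never overflow. *)
Definition weight i j : nat := `|((answer i j).1 + 1)%R|.
Definition transition i c : nat :=
  code B (fun j => (digit B c j * weight i j) %/ (2 ^ prec i + 2)) N.

Hypothesis answer_ge : forall i j, i < n -> j < N -> (-1 <= (answer i j).1)%R.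
Hypothesis answer_le :
  forall i j, i < n -> j < N -> ((answer i j).1 <= (2 ^ prec i + 1)%:Z)%R.
(** A digit counts multiples of [1 / (B - 1)], so the largest digit stands for 1, the value of an
    empty product. *)
Definition init_code : nat := code B (fun=> B.-1) N.

Notation st := (state transition init_code).

Definition score c : int := (\sum_(j < N) cf j * (digit B c j)%:Z)%R.
(** The constant [thr] is in units of [1 / A] and the score in units of [1 / (A * n.+1)]; the factor
    [n.+1] makes them comparable as integers. *)
Definition good c : bool := (thr * n.+1%:Z <= score c)%R.

Let B_gt0 : 0 < B. Proof. by rewrite /B addn1. Qed.

Let weight_le i j : i < n -> j < N -> weight i j <= 2 ^ prec i + 2.
Proof.
move=> i_n jN; have := answer_ge i_n jN; have := answer_le i_n jN.
rewrite /weight; lia.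
Qed.

Lemma weightE i j : i < n -> j < N -> ((answer i j).1 + 1)%R = (weight i j)%:Z.
Proof. by move=> i_n jN; have := answer_ge i_n jN; rewrite /weight; lia. Qed.

Lemma transition_digit i c j : i < n -> j < N ->
  digit B (transition i c) j = (digit B c j * weight i j) %/ (2 ^ prec i + 2).
Proof.
move=> i_n jN; rewrite digit_code// => j' j'N.
rewrite ltn_divLR ?addn2//; have := weight_le i_n j'N.
have : digit B c j' < B by rewrite /digit ltn_mod.
nia.
Qed.

Lemma transition_lt i c : i < n -> transition i c < W.
Proof.
move=> i_n; apply: code_lt => j' j'N.
rewrite ltn_divLR ?addn2//; have := weight_le i_n j'N.
have : digit B c j' < B by rewrite /digit ltn_mod.
nia.
Qed.

Lemma state_lt b i : i <= n -> st b i < W.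
Proof.
elim: i => [_|i IH i_n] /=.
  by apply: code_lt => j _; rewrite prednK.
by case: (b i); [exact: transition_lt|exact/IH/ltnW].
Qed.

Variables (v : nat -> nat) (L m V : nat).
Hypothesis answer2 : forall i j, i < n -> j < N -> `|(answer i j).2| <= 1.
Hypothesis vV : forall i, i < n -> v i <= V.
Hypothesis n_le_m : n <= m.
Hypothesis W_le_m : W <= m.
Hypothesis W_lt : W < 2 ^ L.
Hypothesis prec_le : k0 + n + 2 <= L.
Hypothesis record_le : 2 ^ n * (2 + n * V) <= 2 ^ L.

Notation rec := (record v).

Let L_gt0 : 0 < L. Proof. by move: prec_le; lia. Qed.
Let pow_lt i : i <= n -> 2 ^ (k0 + i + 2) <= 2 ^ L.
Proof.
by move=> i_n; rewrite leq_exp2l// (leq_trans _ prec_le)// leq_add2r leq_add2l.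
Qed.

Let n_lt : n < 2 ^ L.
Proof. by rewrite (leq_trans (ltn_expl n (ltnSn 1)))// leq_exp2l//; lia. Qed.
Let rec_lt b i : i <= n -> rec b i < 2 ^ L.
Proof.
move=> i_n; apply: leq_trans record_le; apply: (@leq_trans (2 ^ i * (2 + i * V))).
  by apply: record_lt => j ji; apply: vV; exact: leq_trans ji i_n.
by rewrite leq_mul ?leq_exp2l// leq_add2l leq_mul.
Qed.

Implicit Types (s : store) (b : nat -> bool).

Lemma eval_baseE s : s 0 0%R = n%:Z -> eval s baseE = B%:Z.
Proof. by rewrite /= => ->; rewrite /B; lia. Qed.

Lemma eval_powE s k : s 0 0%R = n%:Z -> eval s (powE baseE k) = (B ^ k)%:Z.
Proof.
move=> sn; elim: k => [//|k IH].
rewrite -[LHS]/(eval s baseE * eval s (powE baseE k))%R.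
by rewrite eval_baseE// IH expnS PoszM.
Qed.

Lemma eval_digitE s c j :
  s 0 0%R = n%:Z -> s 6 0%R = c%:Z -> eval s (digitE j) = (digit B c j)%:Z.
Proof.
move=> sn sc; pose q := eval s (Bin Div (var 6) (powE baseE j)).
rewrite -[LHS]/(q - (q %/ eval s baseE)%Z * eval s baseE)%R.
have -> : q = (c %/ B ^ j)%:Z.
  by rewrite -[LHS]/(s 6%N 0%R %/ eval s (powE baseE j))%Z sc eval_powE// divz_nat.
by rewrite eval_baseE// divz_nat /digit; have := divn_eq (c %/ B ^ j) B; lia.
Qed.

Lemma eval_codeE s f g k : s 0 0%R = n%:Z ->
  (forall j, j < k -> eval s (f j) = (g j)%:Z) ->
  eval s (codeE f k) = (code B g k)%:Z.
Proof.
move=> sn; elim: k f g => [//|k IH] f g fg.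
rewrite -[LHS]/(eval s (f 0) + eval s baseE *
                eval s (codeE (fun j => f j.+1) k))%R.
rewrite fg// eval_baseE// (IH _ (fun j => g j.+1)) => [|j jk]; last exact: fg.
by rewrite /= PoszD PoszM.
Qed.

Definition answered i s :=
  forall j, j < N -> s (8 + j) 0%R = (answer i j).1.

Lemma eval_stepE s i c : i < n ->
  s 0 0%R = n%:Z -> s 4 0%R = (2 ^ i)%:Z -> s 6 0%R = c%:Z -> answered i s ->
  eval s stepE = (transition i c)%:Z.
Proof.
move=> i_n sn si sc sa; apply: eval_codeE => // j jN.
rewrite -[LHS]/((eval s (digitE j) * (s (8 + j)%N 0%R + 1)) %/
                ((2 ^ k0)%N%:Z * s 4%N 0%R + 2))%Z.
by rewrite (eval_digitE j sn sc) sa// weightE// si -!PoszM -PoszD divz_nat -expnD.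
Qed.

Lemma eval_scoreE s c :
  s 0 0%R = n%:Z -> s 6 0%R = c%:Z -> eval s (scoreE N) = score c.
Proof.
move=> sn sc; rewrite /score; elim: N => [|k IH]; first by rewrite big_ord0.
rewrite big_ord_recr/= -IH -[LHS]/(eval s (scoreE k) +
  cf k * eval s (digitE k))%R.
by rewrite (eval_digitE k sn sc).
Qed.

Definition cell r c : int := (r * W + c)%:Z.
Definition tab s r c : int := s 3 (cell r c).

Lemma eval_addrE s er ec r c : s 0 0%R = n%:Z ->
  eval s er = r%:Z -> eval s ec = c%:Z -> eval s (addrE er ec) = cell r c.
Proof.
move=> sn hr hc.
rewrite -[LHS]/(eval s er * eval s widthE + eval s ec)%R.
by rewrite hr hc eval_powE// /cell PoszD PoszM.
Qed.

Lemma cell_eq r c r' c' : c < W -> c' < W ->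
  (cell r c == cell r' c') = (r == r') && (c == c').
Proof.
move=> cW c'W; have W0 : 0 < W by exact: leq_ltn_trans cW.
apply/eqP/andP => [[e]|[/eqP-> /eqP->]//].
have er : r = r'.
  have := congr1 (divn^~ W) e.
  by rewrite !divnMDl// !divn_small// !addn0.
by move: e; rewrite er => /addnI ->.
Qed.

Definition put r c x s : store := upd s 3 (cell r c) (Num.max (tab s r c) x).

Lemma tab_put s r c x r' c' : c < W -> c' < W ->
  tab (put r c x s) r' c' =
  if (r' == r) && (c' == c) then Num.max (tab s r c) x else tab s r' c'.
Proof. by move=> cW c'W; rewrite /tab /put /upd eqxx/= cell_eq. Qed.

Definition env s := s 0 0%R = n%:Z /\ forall i, i < n -> s 1 i%:Z = (v i)%:Z.

Definition sound i s := forall c, c < W ->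
  tab s i c = 0%R \/ exists2 b, st b i = c & tab s i c = (rec b i)%:Z.

(** Together with [sound], this makes each reachable cell the maximum of the records leading to
    it. *)
Definition complete i s := forall b, ((rec b i)%:Z <= tab s i (st b i))%R.

Definition fresh i s := forall r c, i < r -> c < W -> tab s r c = 0%R.

Definition row_done i s :=
  [/\ env s, s 4 0%R = (2 ^ i)%:Z, sound i s, complete i s & fresh i s].

Definition row_partial i k s :=
  [/\ env s, s 4 0%R = (2 ^ i)%:Z, s 5 0%R = i%:Z & answered i s] /\
  [/\ sound i s, complete i s, sound i.+1 s,
      forall b, st b i < k -> ((rec b i.+1)%:Z <= tab s i.+1 (st b i.+1))%R
    & fresh i.+1 s].

Lemma sound_put i b s : i <= n ->
  sound i s -> sound i (put i (st b i) (rec b i)%:Z s).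
Proof.
move=> i_n snd c cW; rewrite tab_put ?state_lt// eqxx/=.
case: eqVneq => [->|_]; last exact: snd.
case: leP => _; first by right; exists b.
by apply: snd; exact: state_lt.
Qed.

Lemma put_ge r c x s r' c' : c < W -> c' < W ->
  (tab s r' c' <= tab (put r c x s) r' c')%R.
Proof.
move=> cW c'W; rewrite tab_put//; case: ifP => [/andP[/eqP-> /eqP->]|//].
by rewrite le_max lexx.
Qed.

Lemma row_partial_put i k b s : i < n -> st b i.+1 < W ->
  row_partial i k s -> row_partial i k (put i.+1 (st b i.+1) (rec b i.+1)%:Z s).
Proof.
move=> i_n stW [[? ? ? ?] [s1 c1 s2 c2 f2]].
have ii : (i == i.+1) = false by lia.
split; first by split.
split.
- by move=> c cW; rewrite tab_put// ii; exact: s1.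
- by move=> b'; rewrite tab_put ?state_lt ?(ltnW i_n)// ii; exact: c1.
- exact: sound_put.
- move=> b' /c2 le; apply: (le_trans le); apply: put_ge => //.
  exact: state_lt.
- move=> r c lt cW; rewrite tab_put// gtn_eqF//=; exact: f2.
Qed.

Lemma extendP i k : i < n -> k < W ->
  triple O L m (fun s => row_partial i k s /\ s 6 0%R = k%:Z) extend
               (fun s => row_partial i k.+1 s /\ s 6 0%R = k%:Z).
Proof.
move=> i_n kW.
have evalT s : row_partial i k s -> s 6 0%R = k%:Z ->
    eval s (Get 3 (addrE (var 5) (var 6))) = tab s i k.
  move=> [[[sn _] _ si _] _] sk.
  rewrite -[LHS]/(s 3 (eval s (addrE (var 5) (var 6)))).
  by rewrite (@eval_addrE s (var 5) (var 6) i k).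
apply: triple_if => //; last first.
  apply: triple_skip => s _ [[rp sk]]; rewrite evalT// => T0.
  case: rp => [[? ? ? ?] [s1 c1 s2 c2 f2]]; split => //; split => //; split => // b.
  rewrite ltnS leq_eqVlt => /predU1P[E|]; last exact: c2.
  (* Records are positive, so by completeness a cell holding 0 belongs to a state that no set
     reaches. *)
  by have := c1 b; rewrite E T0 lez_nat leqNgt record_gt0.
(* Row [i] depends only on the decisions before [i], so the decision on item [i] can be overwritten
   in a witness of that row. *)
pose with_item b j := (j == i) || b j.
pose without_item b j := (j != i) && b j.
have st1 b : st b i = k -> st (with_item b) i.+1 = transition i k.
  rewrite /= {1}/with_item eqxx /= => <-; congr transition; apply: eq_state => j ji.
  by rewrite /with_item ltn_eqF.
have st0 b : st b i = k -> st (without_item b) i.+1 = k.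
  rewrite /= {1}/without_item eqxx /= => <-; apply: eq_state => j ji.
  by rewrite /without_item ltn_eqF.
have rec1 b : rec (with_item b) i.+1 = 2 * rec b i + (2 ^ i.+1 * v i + 1).
  rewrite /= {2}/with_item eqxx mul1n; congr (2 * _ + _).
  by apply: eq_record => j ji; rewrite /with_item ltn_eqF.
have rec0 b : rec (without_item b) i.+1 = 2 * rec b i.
  rewrite /= {2}/without_item eqxx mul0n addn0; congr (2 * _).
  by apply: eq_record => j ji; rewrite /without_item ltn_eqF.
pose Mid s := exists2 b, st b i = k /\ tab s i k = (rec b i)%:Z &
  [/\ row_partial i k s, s 6 0%R = k%:Z &
      ((rec (with_item b) i.+1)%:Z <= tab s i.+1 (transition i k))%R].
apply: (@triple_seq _ _ _ Mid).
  apply: triple_maximize => // s _ [[rp sk]]; rewrite evalT// => T0.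
  have [[[sn sv] s4 si sa] [s1 _ _ _ _]] := rp.
  have [|[b Eb Tb]] := s1 k kW; first by move=> E; rewrite E in T0.
  have -> : eval s (Bin Add (Bin Mul (Cst 2) (Get 3 (addrE (var 5) (var 6))))
      (Bin Add (Bin Mul (Bin Mul (Cst 2) (var 4)) (Get 1 (var 5))) (Cst 1))) =
      (rec (with_item b) i.+1)%:Z.
    rewrite -[LHS]/(2 * eval s (Get 3 (addrE (var 5) (var 6))) +
                    (2 * s 4%N 0%R * s 1%N (s 5%N 0%R) + 1))%R.
    by rewrite evalT// Tb s4 si sv// rec1 expnS; lia.
  have -> : eval s (addrE (Bin Add (var 5) (Cst 1)) stepE) =
      cell i.+1 (transition i k).
    by apply: eval_addrE => //; [rewrite /= si; lia|exact: eval_stepE].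
  split; first by rewrite bitlen_le; exact: rec_lt.
  rewrite -[Mid _]/(Mid (put i.+1 (transition i k) (rec (with_item b) i.+1)%:Z s)).
  have tW : transition i k < W by exact: transition_lt.
  have ii : (i == i.+1) = false by lia.
  exists b; first by rewrite tab_put// ii.
  split => //; last by rewrite tab_put// !eqxx/= le_max lexx orbT.
  by rewrite -(st1 b)//; apply: row_partial_put; rewrite ?st1.
apply: triple_maximize => // s _ [b [Eb Tb] [rp sk le1]].
have [[[sn sv] s4 si sa] [_ c1 _ _ _]] := rp.
have -> : eval s (Bin Mul (Cst 2) (Get 3 (addrE (var 5) (var 6)))) =
    (rec (without_item b) i.+1)%:Z.
  rewrite -[LHS]/(2 * eval s (Get 3 (addrE (var 5) (var 6))))%R.
  by rewrite evalT// Tb rec0; lia.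
have -> : eval s (addrE (Bin Add (var 5) (Cst 1)) (var 6)) = cell i.+1 k.
  by apply: eval_addrE => //; rewrite /= si; lia.
split; first by rewrite bitlen_le; exact: rec_lt.
rewrite -[upd _ _ _ _]/(put i.+1 k (rec (without_item b) i.+1)%:Z s).
have := @row_partial_put i k (without_item b) s i_n.
rewrite st0// => /(_ kW rp)[[? ? ? ?] [s1' c1' s2' c2' f2']].
split => //; split => //; split => // b'.
rewrite ltnS leq_eqVlt => /predU1P[E|]; last exact: c2'.
(* Principle of optimality: among the sets in state [k] the stored [b] has the largest record, and
   both recurrences increase with the record. *)
have leb : rec b' i <= rec b i by have := c1 b'; rewrite E Tb lez_nat.
rewrite [rec b' _]/= [st b' _]/=; case: (b' i); rewrite E ?mul0n ?mul1n ?addn0.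
  apply: (@le_trans _ _ (tab s i.+1 (transition i k))); last first.
    by apply: put_ge => //; exact: transition_lt.
  by apply: le_trans le1; rewrite lez_nat rec1; lia.
by rewrite tab_put// rec0 !eqxx le_max !lez_nat leq_mul ?orbT.
Qed.

(** [F] is a frame, that is, any property of the store that does not look at the arrays of
    answers. *)
Lemma queriesP i (F : store -> Prop) k : i < n -> k <= N ->
  (forall s, F s -> s 5 0%R = i%:Z) ->
  (forall s j a x, F s -> F (upd s (8 + j) a x)) ->
  triple O L m F (queries k)
    (fun s => F s /\ forall j, j < k -> s (8 + j) 0%R = (answer i j).1).
Proof.
move=> i_n kN F5 Fupd; elim: k kN => [_|k IH kN].
  by apply: triple_skip => s _ Fs; split.
apply: (triple_seq (IH (ltnW kN))); apply: triple_query => // s [Fs sa].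
rewrite -[eval s (var 5)]/(s 5 0%R) -[eval s (Bin _ _ _)]/(k0%:Z + s 5 0%R)%R.
rewrite (F5 _ Fs) -PoszD.
rewrite -[(O _ _ _ _ _)]/(answer i k) /=.
have := answer_ge i_n kN; have := answer_le i_n kN; have := answer2 i_n kN.
have p_lt := pow_lt (ltnW i_n); rewrite expnD in p_lt.
have p1 : 0 < 2 ^ (k0 + i) by rewrite expn_gt0.
case E : (answer i k) => [p q] /= q1 pl pg.
rewrite /prec in pl; split; [|by rewrite bitlen_le; lia|by rewrite bitlen_le; lia|].
  by move: prec_le; lia.
split; first exact/Fupd/Fupd.
move=> j; rewrite ltnS leq_eqVlt => /predU1P[->|jk].
  by rewrite /upd !eqxx/= E.
rewrite -(sa j jk) /upd eqn_add2l.
by rewrite ltn_eqF.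
Qed.

Lemma rowP i : i < n ->
  triple O L m (fun s => row_done i s /\ s 5 0%R = i%:Z)
    (Seq (queries N)
       (Seq (For 6 widthE extend) (Assign 4 (Cst 0) (Bin Mul (Cst 2) (var 4)))))
    (fun s => row_done i.+1 s /\ s 5 0%R = i%:Z).
Proof.
move=> i_n.
apply: (triple_seq (@queriesP i (fun s => row_done i s /\ s 5 0%R = i%:Z) N
  i_n (leqnn N) _ _)) => [s []//|//|].
apply: (@triple_seq _ _ _ (row_partial i W)).
  apply: (@triple_conseq _ _ _ (row_partial i 0) _ (row_partial i W)) => //.
    move=> s [[[? ? s1 c1 f1] ?] ?]; split; split => //.
      by move=> c cW; left; exact: f1.
    by move=> r c ir cW; apply: f1 => //; exact: ltnW.
  apply: (triple_for L_gt0 (J := row_partial i)) => // [k s|k kW].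
    by move=> [[[sn _] _ _ _] _]; rewrite eval_powE.
  exact: extendP.
apply: triple_assign => // s _ [[? s4 s5 _] [_ _ s2 c2 f2]].
rewrite -[eval s (Bin _ _ _)]/(2 * s 4%N 0%R)%R s4.
have -> : (2 * (2 ^ i)%N%:Z)%R = (2 ^ i.+1)%:Z by rewrite expnS; lia.
split; first by rewrite bitlen_le absz_nat; apply: leq_trans (pow_lt i_n);
  rewrite ltn_exp2l//; lia.
split => //; split => //.
by move=> b; apply: c2; apply: state_lt; exact: ltnW.
Qed.

Definition selecting k s :=
  [/\ env s, sound n s, complete n s,
      s 7 0%R = 0%R \/ exists2 b, good (st b n) & s 7 0%R = (rec b n)%:Z
    & forall b, st b n < k -> good (st b n) -> ((rec b n)%:Z <= s 7 0)%R].

Lemma selectP k : k < W ->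
  triple O L m (fun s => selecting k s /\ s 6 0%R = k%:Z) select
               (fun s => selecting k.+1 s /\ s 6 0%R = k%:Z).
Proof.
move=> kW.
have evalc s : selecting k s -> s 6 0%R = k%:Z ->
    eval s (Bin Leq (Bin Mul (Cst thr) (Bin Add (var 0) (Cst 1))) (scoreE N)) =
    Posz (good k).
  move=> [[sn _] _ _ _ _] sk; rewrite -[LHS]/(Posz (thr * (s 0%N 0 + 1) <=
    eval s (scoreE N))%R) (eval_scoreE sn sk) sn /good.
  by rewrite -addn1 PoszD.
apply: triple_if => //; last first.
  apply: triple_skip => s _ [[Js sk]]; rewrite evalc// => /eqP.
  rewrite eqz_nat eqb0 => /negP ng; have [? ? ? ? mx] := Js.
  split => //; split => // b; rewrite ltnS leq_eqVlt => /predU1P[->//|]; exact: mx.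
apply: triple_maximize => // s sL [[Js sk]]; rewrite evalc//.
rewrite eqz_nat eqb0 negbK => gk; have [[sn sv] snd cmp s7 mx] := Js.
have -> : eval s (Get 3 (addrE (var 0) (var 6))) = tab s n k.
  by rewrite -[LHS]/(s 3 (eval s (addrE (var 0) (var 6))))
    (@eval_addrE s (var 0) (var 6) n k).
split; first exact: sL.
rewrite -[eval s (Cst 0)]/(0%R : int).
set s' := upd _ _ _ _.
have s'7 : s' 7 0%R = Num.max (s 7 0%R) (tab s n k) by rewrite /s' /upd !eqxx.
split => //; split => //.
- rewrite s'7; have [T0|[b Eb Tb]] := snd k kW.
    rewrite T0 max_l//; by case: s7 => [->//|[b _ ->]].
  by case: leP => // _; right; exists b; rewrite ?Eb.
- move=> b; rewrite ltnS leq_eqVlt s'7 le_max => /predU1P[E|lt] gb.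
    by rewrite -E cmp orbT.
  by rewrite mx.
Qed.

Definition decoding b t s :=
  [/\ env s, exists z, s 7 0%R = (rec b (n - t) + z * 2 ^ (n - t))%:Z
    & forall i, i < n -> n - t <= i -> s 2 i%:Z = (nat_of_bool (b i))%:Z].

Let one_lt : 1 < 2 ^ L.
Proof. exact: leq_ltn_trans L_gt0 (ltn_expl L (ltnSn 1)). Qed.

Lemma decodeP b t : t < n ->
  triple O L m (fun s => decoding b t s /\ s 5 0%R = t%:Z) decode
               (fun s => decoding b t.+1 s /\ s 5 0%R = t%:Z).
Proof.
move=> tn; pose r := n - t.+1; have Er : n - t = r.+1 by rewrite subnSK.
pose Y z := rec b r + (b r * v r + z) * 2 ^ r.
have dY z : ((2 * Y z + b r) %/ 2 = Y z)%N.
  by rewrite mulnC divnMDl// divn_small ?addn0//; case: (b r).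
apply: (@triple_seq _ _ _ (fun s => [/\ env s, s 5 0%R = t%:Z,
   exists z, s 7 0%R = (2 * Y z + b r)%:Z
   & forall i, i < n -> r <= i -> s 2 i%:Z = (nat_of_bool (b i))%:Z])).
  apply: triple_assign => // s _ [[[sn sv] [z s7] out] s5].
  have E7 : s 7 0%R = (2 * Y z + b r)%:Z.
    by rewrite s7 Er /Y [rec b _]/= expnS; congr Posz; case: (b r); lia.
  have -> : eval s (Bin Defs.Sub (Bin Defs.Sub (var 0) (Cst 1)) (var 5)) = r%:Z.
    by rewrite -[LHS]/(s 0%N 0 - 1 - s 5%N 0)%R sn s5 /r; lia.
  have -> : eval s (Bin Defs.Sub (var 7)
      (Bin Mul (Bin Div (var 7) (Cst 2)) (Cst 2))) = (nat_of_bool (b r))%:Z.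
    rewrite -[LHS]/(s 7%N 0 - (s 7%N 0 %/ 2)%Z * 2)%R E7 divz_nat dY; lia.
  split; first by rewrite bitlen_le absz_nat; apply: leq_ltn_trans one_lt;
    exact: leq_b1.
  split => //; first by exists z.
  move=> i i_n; rewrite leq_eqVlt => /predU1P[<-|ri].
    by rewrite /upd !eqxx.
  by rewrite /upd /= eqz_nat gtn_eqF//= out// Er.
apply: triple_assign => // s sL [? s5 [z s7] out].
rewrite -[eval s (Bin _ _ _)]/(s 7%N 0 %/ 2)%Z.
split.
  rewrite bitlen_le (leq_ltn_trans (absz_divz_le _ _))// -bitlen_le; exact: sL.
split => //; split => //; exists (b r * v r + z).
by rewrite /upd !eqxx/= s7 divz_nat dY.
Qed.

Lemma knapsackP : (exists b, good (st b n)) ->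
  triple O L m (fun s => env s /\ forall j, s 3 j = 0%R) knapsack
    (fun s => exists b, [/\ good (st b n),
       forall b', good (st b' n) -> value v b' n <= value v b n
       & forall i, i < n -> s 2 i%:Z = (nat_of_bool (b i))%:Z]).
Proof.
move=> [b0 gb0].
apply: (@triple_seq _ _ _ (fun s => [/\ env s, s 4 0%R = 1%:Z &
    forall j, s 3 j = 0%R])).
  by apply: triple_assign => // s _ [? ?]; rewrite bitlen_le.
apply: (@triple_seq _ _ _ (row_done 0)).
  apply: triple_assign => // s _ [es s4 s3]; split; first by rewrite bitlen_le.
  have i0W : init_code < W by exact: (@state_lt b0 0).
  have -> : eval s (codeE (fun=> Bin Defs.Sub baseE (Cst 1)) N) = cell 0 init_code.
    rewrite (@eval_codeE _ _ (fun=> B.-1)) => [//||j _]; first by case: es.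
    rewrite -[LHS]/(eval s baseE - 1)%R eval_baseE; last by case: es.
    by move: B_gt0; lia.
  set s' := upd _ _ _ _.
  have s't r c : c < W -> tab s' r c =
      if (r == 0) && (c == init_code) then 1%:Z else 0%R.
    by move=> cW; rewrite /tab /s' /upd eqxx/= cell_eq// s3.
  split => //.
  - move=> c cW; rewrite s't//=; case: eqP => [->|_]; last by left.
    by right; exists b0.
  - by move=> b; rewrite s't ?eqxx.
  - by move=> r c r0 cW; rewrite s't// gtn_eqF.
apply: (@triple_seq _ _ _ (row_done n)).
  apply: (triple_for L_gt0 (J := row_done)) => // [k s [[]]//|k kn].
  exact: rowP.
apply: (@triple_seq _ _ _ (selecting 0)).
  apply: triple_assign => // s _ [? ? ? ? ?]; rewrite bitlen_le expn_gt0.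
  by split => //; split => //; left.
apply: (@triple_seq _ _ _ (fun s => exists b, [/\ good (st b n),
    forall b', good (st b' n) -> value v b' n <= value v b n & decoding b 0 s])).
  apply: (@triple_conseq _ _ _ (selecting 0) _ (selecting W)) => //.
    move=> s [es snd cmp s7 mx]; case: s7 => [s70|[b gb s7b]].
      have := mx b0 (state_lt _ (leqnn n)) gb0.
      by rewrite s70 lez_nat leqNgt record_gt0.
    exists b; split => // [b' gb'|].
      apply: record_le_value; have := mx b' (state_lt _ (leqnn n)) gb'.
      by rewrite s7b lez_nat.
    split => //; first by exists 0; rewrite subn0 mul0n addn0.
    by move=> i i_n; rewrite subn0 leqNgt i_n.
  apply: (triple_for L_gt0 (J := selecting)) => // [k s [[]] sn *|k kW].
    by rewrite eval_powE.
  exact: selectP.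
(* The selected record fixes [b]; decoding is verified for this one [b]. *)
apply: triple_exists => b.
apply: (@triple_conseq _ _ _
  (fun s => [/\ good (st b n),
    forall b', good (st b' n) -> value v b' n <= value v b n & decoding b 0 s]) _
  (fun s => [/\ good (st b n),
    forall b', good (st b' n) -> value v b' n <= value v b n & decoding b n s])).
- by [].
- move=> s [? ? [_ _ out]]; exists b; split => // i i_n.
  by apply: out; rewrite ?subnn.
apply: (triple_for L_gt0 (J := fun t s => [/\ good (st b n),
  forall b', good (st b' n) -> value v b' n <= value v b n & decoding b t s]))
  => // [t s [_ _ [[]]]//|t tn].
move=> s sL [[gb mx ds] s5].
have [s' [u [? ? ? [? ?]]]] := decodeP tn sL (conj ds s5).
by exists s', u.
Qed.

End Program.

(** * Expectations *)

Section BoundedExpectation.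
Context {d : measure_display} {T : measurableType d} {R : realType}.
Variable P : probability T R.
Implicit Types (f g : T -> R).

Definition unit_rv f := measurable_fun [set: T] f /\ forall t, 0 <= f t <= 1.

Lemma bounded_integrable f M : measurable_fun [set: T] f ->
  (forall t, `|f t| <= M) -> P.-integrable [set: T] (EFin \o f).
Proof.
move=> mf fM; apply: measurable_bounded_integrable => //.
  by rewrite (le_lt_trans (probability_le1 _ _)) ?ltry.
exists M; split; first exact: num_real.
by move=> x Mx t _ /=; rewrite (le_trans (fM t))// ltW.
Qed.

Lemma unit_integrable f : unit_rv f -> P.-integrable [set: T] (EFin \o f).
Proof.
move=> [mf f01]; apply: (bounded_integrable (M := 1)) => // t.
by have /andP[f0 f1] := f01 t; rewrite ger0_norm.
Qed.

Lemma unit_rv_prod (I : finType) (f : I -> T -> R) :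
  (forall i, unit_rv (f i)) -> unit_rv (fun t => \prod_i f i t).
Proof.
move=> uf; split.
  by apply: measurable_prod => i; have [] := uf i.
move=> t; rewrite prodr_ge0 => [|i _]; last by have [_ /(_ t)/andP[]] := uf i.
by apply: prodr_ile1 => i _; have [_ /(_ t)] := uf i.
Qed.

Lemma Rintegral_sum (I : finType) (c : I -> R) (f : I -> T -> R) :
  (forall i, unit_rv (f i)) ->
  \int[P]_t (\sum_i c i * f i t) = \sum_i c i * \int[P]_t f i t.
Proof.
move=> uf.
have int i : P.-integrable [set: T] (EFin \o (fun t => c i * f i t)).
  have [mf f01] := uf i; apply: (bounded_integrable (M := `|c i|)).
    exact: measurable_funM.
  move=> t; have /andP[f0 f1] := f01 t.
  by rewrite normrM (ger0_norm f0) ler_piMr.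
elim: (index_enum I) => [|i r IH].
  rewrite big_nil; under eq_Rintegral do rewrite big_nil.
  by rewrite Rintegral_cst// mul0r.
rewrite big_cons; under eq_Rintegral do rewrite big_cons.
rewrite RintegralD//; last first.
  rewrite (_ : EFin \o _ = (fun t => \sum_(i <- r) (c i * f i t)%:E)%E); last first.
    by apply/funext => t /=; rewrite sumEFin.
  by apply: integrable_sum => // i' _; exact: int.
by rewrite IH RintegralZl//; exact: unit_integrable.
Qed.

Lemma Rintegral_prob_cst (e : R) : \int[P]_t (cst e t) = e.
Proof.
rewrite Rintegral_cst// (_ : fine _ = 1) ?mulr1//.
exact: (congr1 fine (probability_setT P)).
Qed.

Lemma Rintegral_indic (A : set T) : measurable A ->
  \int[P]_t (\1_A t) = fine (P A).
Proof. by move=> mA; rewrite /Rintegral integral_indic// setIT. Qed.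

Lemma unit_rv_indic (A : set T) : measurable A -> unit_rv (\1_A : T -> R).
Proof.
move=> mA; split; first exact: measurable_indic.
by move=> t; rewrite indicE ler0n lern1 leq_b1.
Qed.

Lemma Rintegral_dist f g e : unit_rv f -> unit_rv g ->
  (forall t, `|f t - g t| <= e) -> `|\int[P]_t f t - \int[P]_t g t| <= e.
Proof.
move=> uf ug fg; have [mf _] := uf; have [mg _] := ug.
rewrite -RintegralB//; [|exact: unit_integrable..].
have int : P.-integrable [set: T] (EFin \o (fun t => f t - g t)).
  by apply: (bounded_integrable (M := e)) => //; exact: measurable_funB.
apply: (le_trans (le_normr_Rintegral _ int)) => //.
rewrite -[leRHS]Rintegral_prob_cst.
apply: le_Rintegral => //.
  exact: integrable_norm.
exact: finite_measure_integrable_cst.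
Qed.

Lemma Rintegral_unit f : unit_rv f -> 0 <= \int[P]_t f t <= 1.
Proof.
move=> uf; have [_ f01] := uf.
rewrite Rintegral_ge0/=; last by move=> t _; have /andP[] := f01 t.
rewrite -[leRHS]Rintegral_prob_cst.
apply: le_Rintegral => //; [exact: unit_integrable| |].
  exact: finite_measure_integrable_cst.
by move=> t _; have /andP[] := f01 t.
Qed.

End BoundedExpectation.

(** * Product formula for independent sizes *)

Section Independence.
Local Open Scope classical_set_scope.
Local Open Scope ring_scope.
Context {d : measure_display} {T : measurableType d} {R : realType}.
Variables (P : probability T R) (n : nat) (w : 'I_n -> {RV P >-> R}).
Hypothesis w_indep : mutually_independent w.

Lemma indep_prod_indic (A : 'I_n -> set R) : (forall i, measurable (A i)) ->
  \int[P]_t (\prod_i \1_(A i) (w i t)) = \prod_i \int[P]_t (\1_(A i) (w i t)).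
Proof.
move=> mA.
have mw i : measurable (w i @^-1` A i) by exact: measurable_funPTI.
pose B := \bigcap_(i in [set` [set: 'I_n]%SET]) (w i @^-1` A i).
have mB : measurable B.
  by apply: fin_bigcap_measurable => // i _; exact: mw.
have -> : (fun t => \prod_i \1_(A i) (w i t)) = \1_B :> (T -> R).
  apply/funext => t; rewrite indicE.
  have [tB|tB] := boolP (t \in B).
    rewrite big1// => i _; rewrite indicE mem_set//.
    by move/set_mem : tB; apply => /=; rewrite inE.
  have [i Ai] : exists i, w i t \notin A i.
    apply: contrapT => /forallNP h; move/negP : tB; apply; apply/mem_set => i _ /=.
    by apply: contrapT => nA; apply: (h i); apply/negP => /set_mem.
  by rewrite (bigD1 i)//= indicE (negbTE Ai) mul0r.
rewrite Rintegral_indic// w_indep//.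
have -> : (\prod_(i in [set: 'I_n]%SET) P (w i @^-1` A i))%E =
          (\prod_i fine (P (w i @^-1` A i)))%:E.
  rewrite -prodEFin; apply: eq_big => i; first by rewrite inE.
  by move=> _; rewrite fineK// fin_num_measure.
rewrite /=; apply: eq_bigr => i _.
by rewrite -Rintegral_indic//; apply: eq_Rintegral => t _; rewrite !indicE.
Qed.

(** Rounding down to a multiple of [1 / K], for [y] in [0, 1] and [K > 0], written as a sum over
    superlevel sets so that it becomes a combination of indicators of events. *)
Definition stairs K (y : R) : R :=
  \sum_(k < K) K%:R^-1 * (k.+1%:R / K%:R <= y)%R%:R.

Lemma stairsE K y : 0 <= y <= 1 ->
  stairs K.+1 y = (Num.truncn (K.+1%:R * y))%:R / K.+1%:R.
Proof.
move=> /andP[y0 y1]; rewrite /stairs -mulr_sumr mulrC; congr (_ / _).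
have count k m : (\sum_(i < k) (i < m) = minn k m)%N.
  elim: k => [|k IH]; first by rewrite big_ord0 min0n.
  by rewrite big_ord_recr/= IH; lia.
have <- : minn K.+1 (Num.truncn (K.+1%:R * y)) = Num.truncn (K.+1%:R * y).
  apply/minn_idPr; rewrite truncn_le_nat; apply: (@le_lt_trans _ _ K.+1%:R).
    by rewrite ler_piMr.
  by rewrite ltr_nat.
rewrite -count natr_sum; apply: eq_bigr => i _.
by rewrite truncn_ge_nat ?mulr_ge0// ler_pdivrMr// mulrC.
Qed.

Lemma stairs_dist K y : 0 <= y <= 1 -> `|y - stairs K.+1 y| <= K.+1%:R^-1.
Proof.
move=> y01; rewrite stairsE//; have /andP[y0 y1] := y01.
have /andP[h1 h2] := @truncn_itv R (K.+1%:R * y) (mulr_ge0 (ler0n _ _) y0).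
set m := Num.truncn _ in h1 h2 *.
have K0 : (0 : R) < K.+1%:R by rewrite ltr0n.
rewrite -(ler_pM2r K0) mulVf ?gt_eqF// -{2}(gtr0_norm K0) -normrM mulrBl.
rewrite divfK ?gt_eqF// ler_norml -natr1 in h2 *.
by apply/andP; split; lra.
Qed.

Lemma stairs_unit K y : 0 <= y <= 1 -> 0 <= stairs K.+1 y <= 1.
Proof.
move=> y01; rewrite stairsE//; have /andP[y0 y1] := y01.
rewrite divr_ge0//= ler_pdivrMr// mul1r ler_nat truncn_le_nat.
by apply: (@le_lt_trans _ _ K.+1%:R); rewrite ?ler_piMr// ltr_nat.
Qed.

(** Telescoping: replacing one factor costs at most [e], because all the other factors lie in
    [0, 1]. *)
Lemma prod_dist (I : finType) (a b : I -> R) e :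
  (forall i, 0 <= a i <= 1) -> (forall i, 0 <= b i <= 1) ->
  (forall i, `|a i - b i| <= e) -> `|\prod_i a i - \prod_i b i| <= #|I|%:R * e.
Proof.
move=> a01 b01 ab; rewrite -sum1_card.
have -> : (\sum_(i in I) 1 = size (index_enum I))%N.
  by rewrite -sum1_size; exact: eq_bigl.
elim: (index_enum I) => [|i r IH]; first by rewrite !big_nil subrr normr0 mul0r.
rewrite !big_cons; set x := \prod_(j <- r) a j; set y := \prod_(j <- r) b j.
have -> : a i * x - b i * y = (a i - b i) * x + b i * (x - y) by ring.
have x01 : 0 <= x <= 1.
  by rewrite prodr_ge0 ?prodr_ile1// => j _; have /andP[] := a01 j.
have /andP[x0 x1] := x01; have /andP[b0 b1] := b01 i.
rewrite (le_trans (ler_normD _ _))// !normrM (ger0_norm x0) (ger0_norm b0).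
rewrite [size _]/= -natr1 mulrDl mul1r addrC lerD//.
  by rewrite (le_trans _ IH)// ler_piMl.
by rewrite (le_trans _ (ab i))// ler_piMr.
Qed.

(* For staircases, which are combinations of indicators, both sides expand into
   the same sum over the choices of a stair for each factor. *)
Lemma indep_prod (g : 'I_n -> R -> R) :
  (forall i, measurable_fun [set: R] (g i)) -> (forall i x, 0 <= g i x <= 1) ->
  \int[P]_t (\prod_i g i (w i t)) = \prod_i \int[P]_t (g i (w i t)).
Proof.
move=> mg g01.
have ug i : unit_rv (fun t => g i (w i t)).
  by split => // ; exact: measurableT_comp.
pose A K (i : 'I_n) (k : 'I_K.+1) := [set x | k.+1%:R / K.+1%:R <= g i x].
have mA K i k : measurable (A K i k).
  rewrite (_ : A K i k = g i @^-1` `[k.+1%:R / K.+1%:R, +oo[%classic).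
    by rewrite -[X in measurable X]setTI; exact: mg.
  by apply/seteqP; split => x /=; rewrite in_itv/= andbT.
have AE K i x : stairs K.+1 (g i x) =
    \sum_k K.+1%:R^-1 * \1_(A K i k) x.
  apply: eq_bigr => k _; rewrite indicE; congr (_ * _%:R); congr nat_of_bool.
  by apply/idP/idP => [?|/set_mem//]; exact/mem_set.
have uA K i k : unit_rv (fun t => \1_(A K i k) (w i t) : R).
  split; first by apply: measurableT_comp => //; exact: measurable_indic.
  by move=> t; rewrite indicE ler0n lern1 leq_b1.
have us K i : unit_rv (fun t => stairs K.+1 (g i (w i t))).
  split; last by move=> t; exact: stairs_unit.
  under eq_fun do rewrite AE.
  apply: measurable_sum => k; apply: measurable_funM => //.
  by have [] := uA K i k.
have stepP K : \int[P]_t (\prod_i stairs K.+1 (g i (w i t))) =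
    \prod_i \int[P]_t (stairs K.+1 (g i (w i t))).
  under eq_Rintegral => t _.
    under eq_bigr do rewrite AE.
    rewrite bigA_distr_bigA/=.
    under eq_bigr do rewrite big_split/=.
    over.
  rewrite Rintegral_sum; last by move=> f; apply: unit_rv_prod => i; exact: uA.
  under [LHS]eq_bigr => f _ do
    rewrite (indep_prod_indic (fun i => mA K i (f i))) -big_split/=.
  rewrite -(bigA_distr_bigA
    (fun i k => K.+1%:R^-1 * \int[P]_t (\1_(A K i k) (w i t)))).
  apply: eq_bigr => i _; rewrite -Rintegral_sum//.
  by apply: eq_Rintegral => t _; rewrite AE.
apply/eqP; rewrite -subr_eq0 -normr_le0; apply/ler_addgt0Pr => e e0.
(* Each of the two sides is within [n / K.+1] of its staircase version, whence the factor 2. *)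
rewrite add0r; pose K := Num.truncn (2 * n%:R / e).
have K0 : (0 : R) < K.+1%:R by rewrite ltr0n.
have small : n%:R * K.+1%:R^-1 + n%:R * K.+1%:R^-1 <= e.
  have := @truncnS_gt R (2 * n%:R / e); rewrite -/K ltr_pdivrMr// => h.
  by rewrite -mulrDl ler_pdivrMr//; lra.
apply: le_trans small.
rewrite -[X in `|X|](subrKA (\int[P]_t (\prod_i stairs K.+1 (g i (w i t))))).
rewrite (le_trans (ler_normD _ _))// lerD//.
  apply: Rintegral_dist; [exact: unit_rv_prod|exact: unit_rv_prod|].
  move=> t; rewrite -[X in X%:R * _]card_ord; apply: prod_dist => [//|i|i].
    exact: stairs_unit.
  exact: stairs_dist.
rewrite stepP distrC -[X in X%:R * _]card_ord; apply: prod_dist => i.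
- exact: Rintegral_unit.
- exact: Rintegral_unit.
- by apply: Rintegral_dist => // t; exact: stairs_dist.
Qed.

Lemma indep_prod_set (S : {set 'I_n}) (g : R -> R) :
  measurable_fun [set: R] g -> (forall x, 0 <= g x <= 1) ->
  \int[P]_t (\prod_(i in S) g (w i t)) = \prod_(i in S) \int[P]_t (g (w i t)).
Proof.
move=> mg g01; pose h i := if i \in S then g else cst 1.
rewrite [RHS]big_mkcond/=.
transitivity (\prod_i \int[P]_t h i (w i t)).
  rewrite -indep_prod => [|i|i x]; last 2 first.
  - by rewrite /h; case: ifP => _ //; exact: measurable_cst.
  - by rewrite /h; case: ifP => _ //=; rewrite ler01 lexx.
  apply: eq_Rintegral => t _; rewrite big_mkcond/=; apply: eq_bigr => i _.
  by rewrite /h; case: ifP.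
apply: eq_bigr => i _; rewrite /h; case: ifP => // _.
exact: (Rintegral_prob_cst P 1).
Qed.

End Independence.

(** * The polynomial separating sizes at most 1 from sizes above 1 + eps *)

Section ThresholdPolynomial.
Context {R : realType}.
Implicit Types (y u x : R) (N : nat).

Lemma bernoulli_le u N : -1 <= u -> 1 + N%:R * u <= (1 + u) ^+ N.
Proof.
move=> u1; elim: N => [|N IH]; first by rewrite mul0r addr0.
rewrite exprS -natr1; apply: (@le_trans _ _ ((1 + u) * (1 + N%:R * u))).
  have : 0 <= N%:R * u ^+ 2 by rewrite mulr_ge0 ?sqr_ge0.
  by nra.
by rewrite ler_wpM2l//; lra.
Qed.

(** Bernoulli gives [N * u <= (1 + u) ^ N], and [(1 - u) ^ N * (1 + u) ^ N = (1 - u ^ 2) ^ N <= 1].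
    This takes the place of an exponential bound on [(1 - u) ^ N]. *)
Lemma expr_one_minus_le u N : 0 <= u <= 1 -> (1 - u) ^+ N * (N%:R * u) <= 1.
Proof.
move=> /andP[u0 u1].
have u10 : 0 <= (1 - u) ^+ N by rewrite exprn_ge0//; lra.
apply: (@le_trans _ _ ((1 - u) ^+ N * (1 + u) ^+ N)).
  by rewrite ler_wpM2l//; have := @bernoulli_le u N; lra.
rewrite -exprMn exprn_ile1//; nra.
Qed.

(** The probability of at least one success in [N] independent trials of probability [y]. It
    vanishes at 0, so only moments of positive order occur: index [j] stands for exponent [j + 1] in
    the coefficients and in the queries. *)
Definition threshold N y := 1 - (1 - y) ^+ N.
Definition threshold_coef N (j : nat) : int := (-1) ^+ j * ('C(N, j.+1))%:Z.

Lemma thresholdE N y :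
  threshold N y = \sum_(j < N) (threshold_coef N j)%:~R * y ^+ j.+1.
Proof.
rewrite /threshold exprBn big_ord_recl/= !expr1n bin0 !mul1r !expr0 mulr1n.
rewrite opprD addrA subrr add0r -sumrN; apply: eq_bigr => j _.
rewrite /threshold_coef /bump/= add1n expr1n mulr1 exprS mulN1r mulNr mulNrn opprK.
by rewrite rmorphM rmorphXn/= rmorphN1 -mulr_natr mulrAC.
Qed.

Lemma threshold_unit N y : 0 <= y <= 1 -> 0 <= threshold N y <= 1.
Proof.
move=> /andP[y0 y1]; rewrite /threshold.
have : 0 <= (1 - y) ^+ N <= 1 by rewrite exprn_ge0 ?exprn_ile1//; lra.
by lra.
Qed.

(* With [N] about [D / delta], [N * y] is at least [1 / delta] at [y = 1 / D] and
   at most [delta] at [y = 1 / D ^ (1 + eps)]. *)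
Lemma threshold_exists (eps delta : R) : 0 < eps -> 0 < delta ->
  exists D N : nat, [/\ (0 < D)%N,
    forall x, 0 <= x -> x <= 1 -> 1 - delta <= threshold N (D%:R^-1 `^ x)
    & forall x, 1 + eps < x -> threshold N (D%:R^-1 `^ x) <= delta].
Proof.
(* Beyond [1 + eps], [N * y] is at most [(D / delta + 1) * D^-1 / D ^ eps <= (1 / delta + 1) / D ^
   eps], which is at most [delta] as soon as [D ^ eps >= c]. *)
move=> eps0 delta0; pose c : R := (delta^-1 + 1) / delta.
have di0 : 0 < delta^-1 by rewrite invr_gt0.
have c0 : 0 < c by rewrite divr_gt0//; lra.
pose D := (Num.truncn (c `^ eps^-1)).+1; pose N := (Num.truncn (D%:R / delta)).+1.
have D0 : (0 : R) < D%:R by rewrite ltr0n.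
have D1 : (1 : R) <= D%:R by rewrite ler1n.
have Dc : c <= D%:R `^ eps.
  have -> : c = (c `^ eps^-1) `^ eps.
    by rewrite -powRrM mulVf ?gt_eqF// powRr1// ltW.
  apply: ge0_ler_powR; rewrite ?nnegrE ?powR_ge0//; first exact: ltW.
  exact: ltW (truncnS_gt _).
have N1 : D%:R / delta <= N%:R by exact: ltW (truncnS_gt _).
have N2 : N%:R <= D%:R / delta + 1 :> R.
  by rewrite -natr1 lerD2r truncn_le divr_ge0// ltW.
have Di : 0 < (D%:R^-1 : R) <= 1 by rewrite invr_gt0 D0 invf_le1.
clearbody N; clearbody D; exists D, N; split => [|x|x].
- by move: D0; rewrite ltr0n.
- move=> x0 x1; set y := _ `^ _.
  have y1 : y <= 1 by rewrite -(powRr0 D%:R^-1); exact: ger_powR.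
  have yD : D%:R^-1 <= y.
    by rewrite -[leLHS]powRr1 ?(ltW (proj1 (andP Di)))//; exact: ger_powR.
  have y0 : 0 <= y by exact: powR_ge0.
  have := @expr_one_minus_le y N; rewrite y0 y1 => /(_ isT).
  rewrite /threshold; set z := (1 - y) ^+ N => h.
  have z0 : 0 <= z by rewrite exprn_ge0// subr_ge0.
  have Ny : delta^-1 <= N%:R * y.
    apply: (@le_trans _ _ (D%:R / delta * D%:R^-1)).
      by rewrite mulrAC divff ?gt_eqF// mul1r.
    by rewrite ler_pM// ?divr_ge0 ?invr_ge0// ltW.
  suff : z <= delta by lra.
  rewrite -[delta]mul1r -ler_pdivrMr// (le_trans _ h)// ler_wpM2l//.
move=> x1; have yE : D%:R^-1 `^ x <= D%:R^-1 / D%:R `^ eps.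
  apply: (@le_trans _ _ (D%:R^-1 `^ (1 + eps))).
    by apply: ger_powR => //; exact: ltW.
  rewrite -powR_inv1 ?ler0n// -powRrM mulN1r opprD powRD; last first.
    by rewrite (gt_eqF D0) implybT.
  by rewrite (powRN _ eps).
set y := _ `^ _ in yE *.
have y1 : y <= 1.
  rewrite -(powRr0 D%:R^-1); apply: ger_powR => //; lra.
have := @bernoulli_le (- y) N; rewrite lerN2 => /(_ y1).
rewrite /threshold; set z := (1 - y) ^+ N => h; suff : N%:R * y <= delta by lra.
have De0 : 0 < D%:R `^ eps by rewrite powR_gt0.
apply: (@le_trans _ _ ((D%:R / delta + 1) * (D%:R^-1 / D%:R `^ eps))).
  by rewrite ler_pM// ?powR_ge0.
rewrite mulrA ler_pdivrMr// mulrDl mulrAC divff ?gt_eqF// !mul1r.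
apply: (@le_trans _ _ (delta^-1 + 1)); first by rewrite lerD2l; case/andP : Di.
by rewrite -ler_pdivrMl// mulrC.
Qed.

End ThresholdPolynomial.

(** * Error analysis of the rounded products *)

Section Rounding.
Context {R : realType}.
Variables (N A D k0 : nat) (cf : nat -> int) (O : oracle) (n : nat).
Variable mu : nat -> nat -> R.
Hypothesis A_gt0 : (0 < A)%N.
Hypothesis mu01 : forall i j, 0 <= mu i j <= 1.
Hypothesis answer_ge :
  forall i j, (i < n)%N -> (j < N)%N -> -1 <= (answer D k0 O i j).1.
Hypothesis answer_le : forall i j, (i < n)%N -> (j < N)%N ->
  (answer D k0 O i j).1 <= (2 ^ (k0 + i) + 1)%N%:Z.
Hypothesis weight_mu : forall i j, (i < n)%N -> (j < N)%N ->
  `|(weight D k0 O i j)%:R / (2 ^ (k0 + i) + 2)%:R - mu i j| <= 2 / 2 ^+ (k0 + i).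

Let B := (A * n.+1 + 1)%N.
Let M : R := (A * n.+1)%:R.
Let M_gt0 : 0 < M. Proof. by rewrite ltr0n muln_gt0 A_gt0. Qed.
Let st := state (transition N A D k0 O n) (init_code N A n).

Definition moments (b : nat -> bool) i j : R :=
  \prod_(k < i) (if b k then mu k j else 1).

Lemma moments_unit b i j : 0 <= moments b i j <= 1.
Proof.
have f01 (k : 'I_i) : 0 <= (if b k then mu k j else 1) <= 1.
  by case: ifP => // _; rewrite ler01 lexx.
by rewrite prodr_ge0 ?prodr_ile1// => k _; have /andP[] := f01 k.
Qed.

(* The query for item [i] has precision [k0 + i], so the errors of the oracle sum
   to a geometric series. *)
Lemma state_digit b i j : (i <= n)%N -> (j < N)%N ->
  `|(digit B (st b i) j)%:R / M - moments b i j|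
    <= i%:R / M + 4 / 2 ^+ k0 * (1 - 2 ^- i).
Proof.
move=> + jN; elim: i => [_|i IH i_n].
  rewrite /moments big_ord0 /st/= /B /init_code addn1 digit_code//.
  by rewrite divff ?gt_eqF// subrr normr0 mul0r expr0 invr1 subrr mulr0 addr0.
have {}IH := IH (ltnW i_n).
have stepE : 4 / 2 ^+ k0 * (1 - 2 ^- i.+1) =
    4 / 2 ^+ k0 * (1 - 2 ^- i) + 2 / 2 ^+ (k0 + i) :> R.
  by rewrite exprD exprS; field; rewrite !expf_neq0.
have Mi0 : 0 < M^-1 by rewrite invr_gt0.
have errE : i.+1%:R / M + 4 / 2 ^+ k0 * (1 - 2 ^- i.+1) =
    M^-1 + (i%:R / M + 4 / 2 ^+ k0 * (1 - 2 ^- i)) + 2 / 2 ^+ (k0 + i).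
  by rewrite stepE -natr1; ring.
rewrite errE; set e := (i%:R / M + _) in IH *.
have e2 : 0 <= 2 / 2 ^+ (k0 + i) :> R by rewrite divr_ge0// exprn_ge0.
rewrite /moments big_ord_recr/= -/(moments b i j) -/(st b i).
have [bi|bi] := boolP (b i); last first.
  by rewrite mulr1 (le_trans IH)// addrAC lerDr addr_ge0// ltW.
rewrite transition_digit//.
have := weight_mu i_n jN.
have wQ : (weight D k0 O i j <= 2 ^ (k0 + i) + 2)%N.
  by have := answer_ge i_n jN; have := answer_le i_n jN; rewrite /weight; lia.
have dM : (digit B (st b i) j <= A * n.+1)%N.
  have : (digit B (st b i) j < B)%N by rewrite ltn_mod /B addn1.
  by rewrite {2}/B addn1 ltnS.
rewrite -/B; set Q := (2 ^ (k0 + i) + 2)%N in wQ *.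
set a := weight _ _ _ _ _ in wQ *; set c := digit _ _ _ in IH dM *.
have Q0 : (0 : R) < Q%:R by rewrite ltr0n /Q addn2.
set r : R := a%:R / Q%:R => r_mu.
have r01 : 0 <= r <= 1 by rewrite divr_ge0//= ler_pdivrMr// mul1r ler_nat.
have d1 : `|(c * a %/ Q)%:R / M - c%:R / M * r| <= M^-1.
  have -> : (c * a %/ Q)%:R / M - c%:R / M * r =
      - ((c * a %% Q)%:R / Q%:R * M^-1).
    have -> : c%:R / M * r = (c * a)%:R / M / Q%:R by rewrite natrM /r; ring.
    rewrite {2}(divn_eq (c * a) Q) natrD natrM.
    by field; rewrite (gt_eqF Q0) nat1r !pnatr_eq0 (gtn_eqF A_gt0).
  set q : R := _ / Q%:R; have q01 : 0 <= q <= 1.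
    by rewrite divr_ge0//= ler_pdivrMr// mul1r ler_nat ltnW// ltn_mod /Q addn2.
  have /andP[q0 q1] := q01.
  by rewrite normrN normrM (ger0_norm q0) (gtr0_norm Mi0) ler_piMl// ltW.
set p := moments b i j in IH *.
have /andP[p0 p1] := moments_unit b i j; rewrite -/p in p0 p1.
(* Three errors: rounding down the new digit, the earlier error times a factor at most 1, and the
   error of the oracle times a product at most 1. *)
have -> : (c * a %/ Q)%:R / M - p * mu i j =
  ((c * a %/ Q)%:R / M - c%:R / M * r) + (c%:R / M - p) * r + p * (r - mu i j).
  by ring.
have /andP[r0 r1] := r01.
rewrite (le_trans (ler_normD _ _))// lerD//.
  rewrite (le_trans (ler_normD _ _))// lerD// normrM (ger0_norm r0).
  by rewrite (le_trans _ IH)// ler_piMr.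
by rewrite normrM (ger0_norm p0) (le_trans _ r_mu)// ler_piMl.
Qed.

Definition coef_norm : R := \sum_(j < N) `|cf j|%:~R.

(** Since [M = A * n.+1], the [n] rounding errors of [1 / M] sum to at most [1 / A], and the
    geometric series of oracle errors stays below [4 / 2 ^ k0]: neither bound depends on [n]. *)
Lemma score_dist b :
  `|(score N A cf n (st b n))%:~R / M - \sum_(j < N) (cf j)%:~R * moments b n j|
    <= coef_norm * (A%:R^-1 + 4 / 2 ^+ k0).
Proof.
rewrite /score rmorph_sum/= mulr_suml -sumrB mulr_suml.
apply: (le_trans (ler_norm_sum _ _ _)); apply: ler_sum => j _.
rewrite rmorphM/= -mulrA -mulrBr normrM intr_norm ler_wpM2l//.
apply: (le_trans (state_digit b (leqnn n) (ltn_ord j))).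
apply: lerD.
  rewrite ler_pdivrMr// /M natrM mulrA mulVf ?gt_eqF ?ltr0n// mul1r.
  by rewrite ler_nat.
rewrite ler_piMr ?divr_ge0 ?exprn_ge0// gerBl invr_ge0 exprn_ge0//.
Qed.

End Rounding.

(** * Moments from the oracle, and their relation to the fitting probability *)

Section SizeTransform.
Local Open Scope classical_set_scope.
Local Open Scope ring_scope.
Context {d : measure_display} {T : measurableType d} {R : realType}.
Variables (P : probability T R) (n : nat) (w : 'I_n -> {RV P >-> R}).
Hypothesis w_ge0 : forall i t, 0 <= w i t.
Variable D : nat.
Hypothesis D_gt0 : (0 < D)%N.

Let Di_gt0 : (0 : R) < D%:R^-1. Proof. by rewrite invr_gt0 ltr0n. Qed.
Let Di_le1 : D%:R^-1 <= 1 :> R. Proof. by rewrite invf_le1 ?ltr0n// ler1n. Qed.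

Lemma powR_unit (x : R) : 0 <= x -> 0 <= D%:R^-1 `^ x <= 1.
Proof.
move=> x0; rewrite powR_ge0/= -[leRHS](powRr0 D%:R^-1).
by apply: ger_powR => //; rewrite Di_gt0 Di_le1.
Qed.

Definition moment (i : 'I_n) (j : nat) : R :=
  \int[P]_t (D%:R^-1 `^ w i t) ^+ j.+1.

Lemma powR_rv i j : unit_rv (fun t => (D%:R^-1 `^ w i t) ^+ j.+1).
Proof.
split=> [|t].
  by apply: measurable_funX; apply: measurableT_comp => //; exact: measurable_powRr.
have /andP[y0 y1] := powR_unit (w_ge0 i t).
by rewrite exprn_ge0//= exprn_ile1.
Qed.

Lemma moment_unit i j : 0 <= moment i j <= 1.
Proof. exact/Rintegral_unit/powR_rv. Qed.

Lemma cexpectation_powR i j (phi : R[i]) :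
  phi = Complex (1%:~R / (D ^ j.+1)%:R) (0%:~R / (D ^ j.+1)%:R) ->
  cexpectation P (fun t => cpow phi (w i t)) = Complex (moment i j) 0.
Proof.
move=> ->; rewrite /cexpectation /cpow /= mul0r mul1r.
have a0 : (0 : R) < (D ^ j.+1)%:R^-1 by rewrite invr_gt0 ltr0n expn_gt0 D_gt0.
(* The base is real and positive, so its argument is [acos 1 = 0]: the complex power is the real one
   and the imaginary part vanishes. *)
rewrite expr0n/= addr0 sqrtr_sqr gtr0_norm// ltxx divff ?gt_eqF// acos1.
congr Complex.
  rewrite /moment /Rintegral unlock; congr fine; apply: eq_integral => t _.
  rewrite mulr0 cos0 mulr1 natrX -exprVn -(@powR_mulrn _ D%:R^-1).
    2: by rewrite invr_ge0.
  by rewrite -powRrM mulrC powRrM powR_mulrn ?powR_ge0.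
rewrite unlock (eq_integral (cst 0%E)) ?integral0// => t _.
by rewrite mulr0 sin0 mulr0.
Qed.

Lemma normc_le (a b e : R) :
  Normc.normc (Complex a b) <= e -> `|a| <= e /\ `|b| <= e.
Proof.
move=> h; split; apply: le_trans h; rewrite -sqrtr_sqr /= ler_wsqrtr//.
  by rewrite lerDl sqr_ge0.
by rewrite lerDr sqr_ge0.
Qed.

Lemma answers_moment (O : oracle) (i : 'I_n) j k : answers w O ->
  let: (p, q) := O i 1 0 (D ^ j.+1)%N k in
  [/\ -1 <= p, p <= (2 ^ k + 1)%N%:Z, (`|q| <= 1)%N &
      `|(`|(p + 1)%R|%N)%:R / (2 ^ k + 2)%N%:R - moment i j| <= 2 / 2 ^+ k].
Proof.
move=> ansO; have := ansO i 1 0 (D ^ j.+1)%N k; rewrite expn_gt0 D_gt0 => /(_ isT).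
cbv zeta; rewrite (@cexpectation_powR i j _ erefl) /= mul0r mul1r.
have a0 : (0 : R) < (D ^ j.+1)%:R^-1 by rewrite invr_gt0 ltr0n expn_gt0 D_gt0.
rewrite expr0n/= addr0 sqrtr_sqr gtr0_norm// invf_le1 ?ltr0n ?expn_gt0 ?D_gt0//.
rewrite ler1n expn_gt0 D_gt0 => /(_ isT).
case: (O i 1 0 (D ^ j.+1)%N k) => p q.
have k0 : (0 : R) < 2 ^+ k by rewrite exprn_gt0.
have ik0 : (0 : R) < 2 ^- k by rewrite invr_gt0.
move=> /normc_le[]; rewrite /= subr0 => hp hq.
have /andP[m0 m1] := moment_unit i j; set x := moment i j in hp m0 m1 *.
have {}hp : `|p%:~R - x * 2 ^+ k| <= 1.
  rewrite -(ler_pM2r ik0) mul1r -{1}(gtr0_norm ik0).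
  by rewrite -normrM mulrBl mulfK ?gt_eqF.
have {}hq : `|q%:~R| <= 1 :> R.
  rewrite -(ler_pM2r ik0) mul1r -{1}(gtr0_norm ik0).
  by rewrite -normrM.
have xk : 0 <= x * 2 ^+ k <= 2 ^+ k by rewrite mulr_ge0 ?ler_piMl// ltW.
have pN1 : -1 <= p by rewrite -(ler_int R) rmorphN1; move: hp; rewrite ler_norml; lra.
split => //.
- rewrite -(ler_int R) -pmulrn natrD natrX; move: hp; rewrite ler_norml; lra.
- by rewrite -lez_nat abszE -(ler_int R) intr_norm.
have -> : `|(p + 1)%R|%N%:R = p%:~R + 1 :> R.
  have p0 : 0 <= p + 1 by rewrite -lerBlDr sub0r.
  by rewrite pmulrn gez0_abs// rmorphD.
rewrite natrD natrX; set z : R := 2 ^+ k in k0 hp xk *.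
have z2 : 0 < z + 2 by lra.
rewrite -(ler_pM2r z2) -[X in _ * X <= _](gtr0_norm z2) -normrM mulrBl divfK ?gt_eqF//.
(* The numerator is off by [(p - x * 2 ^ k) + (1 - 2 * x)], where both terms are at most 1 in
   absolute value. *)
apply: (@le_trans _ _ 2); last first.
  by rewrite mulrDr mulfVK ?gt_eqF// lerDl mulr_ge0// divr_ge0// ltW.
by move: hp; rewrite !ler_norml; nra.
Qed.

Lemma size_of_ge0 S t : 0 <= size_of w S t.
Proof. exact: sumr_ge0. Qed.

Lemma measurable_size_of S : measurable_fun [set: T] (size_of w S).
Proof.
rewrite /size_of; under eq_fun do rewrite big_mkcond/=.
by apply: measurable_sum => i; case: (i \in S).
Qed.

Lemma powR_size_of S t : D%:R^-1 `^ size_of w S t = \prod_(i in S) D%:R^-1 `^ w i t.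
Proof.
rewrite /size_of; apply: (big_morph (powR D%:R^-1)) => [x y|]; last exact: powRr0.
by rewrite powRD//; apply/implyP => _; rewrite (gt_eqF Di_gt0).
Qed.

Lemma measurable_fits S c : measurable [set t | size_of w S t <= c].
Proof.
rewrite -[X in measurable X]setTI.
rewrite (_ : [set t | _] = size_of w S @^-1` `]-oo, c]%classic).
  exact: measurable_size_of.
by apply/seteqP; split => t /=; rewrite in_itv.
Qed.

Definition transform N S : R := \int[P]_t threshold N (D%:R^-1 `^ size_of w S t).

Lemma transform_rv N S : unit_rv (fun t => threshold N (D%:R^-1 `^ size_of w S t)).
Proof.
split => [|t]; last exact/threshold_unit/powR_unit/size_of_ge0.
apply: measurable_funB => //; apply: measurable_funX.
apply: measurable_funB => //; apply: measurableT_comp; last exact: measurable_size_of.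
exact: measurable_powRr.
Qed.

Lemma transformE N S : mutually_independent w ->
  transform N S = \sum_(j < N) (threshold_coef N j)%:~R * \prod_(i in S) moment i j.
Proof.
move=> w_indep; rewrite /transform.
under eq_Rintegral do rewrite thresholdE.
rewrite Rintegral_sum => [|j]; last first.
  split => [|t].
    apply: measurable_funX; apply: measurableT_comp; last exact: measurable_size_of.
    exact: measurable_powRr.
  have /andP[y0 y1] := powR_unit (size_of_ge0 S t).
  by rewrite exprn_ge0//= exprn_ile1.
apply: eq_bigr => j _; congr (_ * _).
(* The product formula wants a function bounded by 1 on all of [R], but [D ^ - x] may exceed 1 at
   negative [x]; the truncation changes nothing on the nonnegative sizes. *)
pose g (x : R) : R := Num.min 1 (D%:R^-1 `^ x) ^+ j.+1.
have gE i t : g (w i t) = (D%:R^-1 `^ w i t) ^+ j.+1.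
  by rewrite /g min_r//; have /andP[] := powR_unit (w_ge0 i t).
rewrite /moment; under eq_bigr => i _ do under eq_Rintegral do rewrite -gE.
rewrite -indep_prod_set//.
- apply: eq_Rintegral => t _; rewrite powR_size_of -prodrXl.
  by apply: eq_bigr => i _; rewrite gE.
- apply: measurable_funX; apply: measurable_minr => //; exact: measurable_powRr.
- move=> x; rewrite exprn_ge0 ?exprn_ile1//= ?ge_min ?lexx//;
    by rewrite le_min ler01 powR_ge0.
Qed.

Lemma prob_fits_fin S c : prob_fits w S c = (fine (prob_fits w S c))%:E.
Proof. by rewrite fineK// fin_num_measure//; exact: measurable_fits. Qed.

(** Pointwise comparison under the integral: on the event the hypothesis applies, and off the event
    [- e <= 0 <= threshold]. The upper bound below is dual, with [threshold <= 1] on the event. *)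
Lemma prob_le_transform N S c e :
  (forall x, 0 <= x -> x <= c -> 1 - e <= threshold N (D%:R^-1 `^ x)) -> 0 <= e ->
  fine (prob_fits w S c) - e <= transform N S.
Proof.
move=> h e0; have mA := @measurable_fits S c.
rewrite /prob_fits -Rintegral_indic// -[X in _ - X](Rintegral_prob_cst P).
rewrite -RintegralB//; [|exact/unit_integrable/unit_rv_indic|
  exact: finite_measure_integrable_cst].
apply: le_Rintegral => // [||t _].
- apply: (@bounded_integrable _ _ _ P _ (1 + e)).
    by apply: measurable_funB => //; exact: measurable_indic.
  move=> t; rewrite indicE /cst; case: (_ \in _) => /=; rewrite ler_norml; lra.
- exact/unit_integrable/transform_rv.
rewrite indicE /cst /=; have s0 := size_of_ge0 S t.
have /andP[q0 _] := (transform_rv N S).2 t.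
have [tA|_] := boolP (t \in _); last by move: q0 => /=; lra.
by apply: h => //; move/set_mem : tA.
Qed.

Lemma transform_le_prob N S c e :
  (forall x, c < x -> threshold N (D%:R^-1 `^ x) <= e) -> 0 <= e ->
  transform N S <= fine (prob_fits w S c) + e.
Proof.
move=> h e0; have mA := @measurable_fits S c.
rewrite /prob_fits -Rintegral_indic// -[X in _ + X](Rintegral_prob_cst P).
rewrite -RintegralD//; [|exact/unit_integrable/unit_rv_indic|
  exact: finite_measure_integrable_cst].
apply: le_Rintegral => // [||t _].
- exact/unit_integrable/transform_rv.
- apply: (@bounded_integrable _ _ _ P _ (1 + e)).
    by apply: measurable_funD => //; exact: measurable_indic.
  move=> t; rewrite indicE /cst; case: (_ \in _) => /=; rewrite ler_norml; lra.
rewrite indicE /cst /=; have /andP[_ q1] := (transform_rv N S).2 t.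
have [_|/negP tA] := boolP (t \in _); first by move: q1 => /=; lra.
rewrite add0r; apply: h; rewrite ltNge; apply/negP => le; apply: tA.
exact/mem_set.
Qed.

End SizeTransform.

(** * The algorithm and its guarantee *)

Section Decoding.
Variable n : nat.
Implicit Types (b : nat -> bool) (S : {set 'I_n}) (v : 'I_n -> nat).

(** A bridge between the program, which numbers items by [nat], and the statement, which uses
    ['I_n]. *)
Definition extend_fun (A : Type) (x : A) (f : 'I_n -> A) (k : nat) : A :=
  if insub k is Some i then f i else x.

Lemma extend_funE (A : Type) (x : A) f (i : 'I_n) : extend_fun x f i = f i.
Proof. by rewrite /extend_fun valK. Qed.

Definition chosen b : {set 'I_n} := [set i : 'I_n | b i]%SET.

Lemma chosen_mem S : chosen (extend_fun false (fun i => i \in S)) = S.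
Proof. by apply/setP => i; rewrite inE extend_funE. Qed.

Lemma value_profit v b : value (extend_fun 0%N v) b n = profit v (chosen b).
Proof.
rewrite /value /profit [RHS]big_mkcond/=; apply: eq_bigr => i _.
by rewrite extend_funE inE; case: (b i); rewrite ?mul1n ?mul0n.
Qed.

Lemma env_input v : env n (extend_fun 0%N v) (input v).
Proof.
split => // i i_n; rewrite /= /extend_fun.
by case: insub.
Qed.

Lemma bitlen_input L v : (n < 2 ^ L)%N -> (forall i, (v i < 2 ^ L)%N) ->
  bits_le L (input v).
Proof.
move=> nL vL [|[|a]] [[|k]|k]; rewrite bitlen_le //= ?expn_gt0//.
- by case: insub => [i|]; rewrite ?absz_nat ?vL ?expn_gt0.
- by case: insub => [i|]; rewrite ?absz_nat ?vL ?expn_gt0.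
Qed.

Lemma profit_lt v i : (v i < 2 ^ input_size v)%N.
Proof.
rewrite -[v i]/(`|(v i)%:Z|%N) -bitlen_le /input_size (bigD1 i)//=.
by rewrite addnCA leq_addr.
Qed.

End Decoding.

(** A single length serves all cells: state indices below [W], inputs below [2 ^ x], precisions up
    to [k + n], and records below [2 ^ (3 * x)]. Counting [W] itself instead of its logarithm is
    wasteful but polynomial. *)
Lemma bit_budget (W x k n : nat) : (n < x)%N ->
  [/\ (W <= W + 3 * x + k + 2)%N, (x <= W + 3 * x + k + 2)%N,
      (k + n + 2 <= W + 3 * x + k + 2)%N & (x + (x + x) <= W + 3 * x + k + 2)%N].
Proof. by move=> nx; split; lia. Qed.

Lemma inv_nat_le (R : realType) (e : R) : 0 < e ->
  exists2 A : nat, (0 < A)%N & A%:R^-1 <= e.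
Proof.
move=> e0; exists (Num.truncn e^-1).+1 => //.
rewrite -[leRHS]invrK lef_pV2 ?posrE ?invr_gt0//.
exact: ltW (truncnS_gt _).
Qed.

Theorem theorem5 (R : realType) (eps gamma : R)
  (eps_gt0 : 0 < eps) (gamma_gt0 : 0 < gamma) (gamma_le1 : gamma <= 1) :
  exists (alg : cmd) (C K : nat),
  forall (n : nat) (v : 'I_n -> nat)
    (d : measure_display) (T : measurableType d) (P : probability T R)
    (w : 'I_n -> {RV P >-> R}) (O : oracle),
  (forall (i : 'I_n) (t : T), 0 <= w i t) ->
  mutually_independent w ->
  answers w O ->
  exists (s : store) (time : nat),
  [/\ exec O alg (input v) s time,
      (time <= C * (input_size v).+1 ^ K)%N,
      (1 - eps) * (optimum v w gamma)%:R <= (profit v (output n s))%:R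
    & (((1 - eps) * gamma)%:E <= prob_fits w (output n s) (1 + eps))%E].
Proof.
(* Five losses of [delta] lead from [gamma] to [(1 - eps) * gamma]: the polynomial for feasible
   sets, their rounding, the integer threshold, the rounding of the output, and the polynomial for
   the output. *)
pose delta := eps * gamma / 5.
have delta0 : 0 < delta by rewrite divr_gt0// mulr_gt0.
have [D [N [D0 threshold_ge threshold_le]]] := threshold_exists eps_gt0 delta0.
pose G : R := coef_norm N (threshold_coef N).
have G0 : 0 <= G by apply: sumr_ge0 => j _; rewrite ler0z.
(* The two errors [1 / A] and [4 / 2 ^ k0] get [kappa] each and are then multiplied by [G]; writing
   [G + 1] avoids dividing by 0. *)
pose kappa := delta / (2 * (G + 1)).
have G20 : 0 < 2 * (G + 1) by lra.
have kappa0 : 0 < kappa by rewrite divr_gt0.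
have [A A0 Ak] := inv_nat_le kappa0.
have A0R : 0 < A%:R :> R by rewrite ltr0n.
(* This gives [4 / 2 ^ k0 = 2 ^ - A <= 1 / A]. *)
pose k0 := (A + 2)%N.
have k0k : 4 / 2 ^+ k0 <= kappa.
  have -> : 4 / 2 ^+ k0 = (2 ^+ A)^-1 :> R.
    by rewrite /k0 exprD; field; rewrite expf_neq0.
  apply: le_trans Ak; rewrite -natrX lef_pV2 ?posrE ?ltr0n ?expn_gt0//.
  by rewrite ler_nat ltnW// ltn_expl.
have rounding : G * (A%:R^-1 + 4 / 2 ^+ k0) <= delta.
  apply: (@le_trans _ _ (G * (kappa + kappa))).
    by rewrite ler_wpM2l// lerD.
  have -> : G * (kappa + kappa) = delta * (G / (G + 1)).
    by rewrite /kappa; field; lra.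
  by rewrite ler_piMr ?(ltW delta0)// ler_pdivrMr; lra.
have Ad : A%:R^-1 <= delta.
  rewrite (le_trans Ak)// /kappa ler_pdivrMr// ler_peMr ?(ltW delta0)//; lra.
(* The program cannot hold the real number [gamma - 2 * delta], the least value that a feasible set
   can show; rounding it down in units of [1 / A] costs at most [1 / A <= delta]. *)
pose thr := Num.floor (A%:R * (gamma - 2 * delta)).
have thr_le : thr%:~R / A%:R <= gamma - 2 * delta.
  by rewrite ler_pdivrMr// mulrC floor_le.
have thr_ge : gamma - 3 * delta <= thr%:~R / A%:R.
  rewrite ler_pdivlMr//; have := floorD1_gt (A%:R * (gamma - 2 * delta)).
  have : 1 <= A%:R * delta by rewrite mulrC -ler_pdivrMr// mul1r.
  by rewrite -/thr rmorphD/=; lra.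
pose cf := threshold_coef N.
pose alg := knapsack N A D k0 cf thr.
pose Wx x := ((A * x + 1) ^ N)%N.
pose L x := (Wx x + 3 * x + k0 + 2)%N.
pose m x := (x + Wx x)%N.
have pW : poly_bounded Wx.
  apply: poly_boundedX; apply: poly_boundedD; last exact: poly_bounded_cst.
  apply: poly_boundedM; [exact: poly_bounded_cst|exact: poly_bounded_id].
have pL : poly_bounded L.
  do 2!(apply: poly_boundedD; last exact: poly_bounded_cst).
  apply: poly_boundedD => //.
  apply: poly_boundedM; [exact: poly_bounded_cst|exact: poly_bounded_id].
have pm : poly_bounded m by apply: poly_boundedD => //; exact: poly_bounded_id.
have [C [K CK]] := poly_bounded_cbound alg pL pm.
exists alg, C, K => n v d T P w O w0 w_indep ansO.
pose x := (input_size v).+1; have x0 : (0 < x)%N by [].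
have nx : (n < x)%N by rewrite ltnS leq_addr.
pose vv := extend_fun 0%N v.
pose mu i j := extend_fun 0 (fun i' : 'I_n => moment w D i' j) i.
have mu01 i j : 0 <= mu i j <= 1.
  rewrite /mu /extend_fun; case: insub => [i'|]; last by rewrite lexx ler01.
  exact: moment_unit.
have ans i j : (i < n)%N ->
    [/\ -1 <= (answer D k0 O i j).1,
        (answer D k0 O i j).1 <= (2 ^ (k0 + i) + 1)%N%:Z,
        (`|(answer D k0 O i j).2| <= 1)%N &
        `|(weight D k0 O i j)%:R / (2 ^ (k0 + i) + 2)%:R - mu i j|
           <= 2 / 2 ^+ (k0 + i)].
  move=> i_n; have := answers_moment w0 D0 (Ordinal i_n) j (k0 + i) ansO.
  rewrite /mu -[i in extend_fun _ _ i]/(val (Ordinal i_n)) extend_funE.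
  rewrite /weight /answer; case: (O _ _ _ _ _) => p q; exact.
pose st := state (transition N A D k0 O n) (init_code N A n).
have transform_moments b :
    \sum_(j < N) (cf j)%:~R * moments mu b n j = transform w D N (chosen n b).
  rewrite transformE//; apply: eq_bigr => j _; congr (_ * _).
  rewrite [RHS]big_mkcond/=; apply: eq_bigr => i _.
  by rewrite inE /mu extend_funE.
pose ratio b : R := (score N A cf n (st b n))%:~R / (A * n.+1)%:R.
have ratio_dist b : `|ratio b - transform w D N (chosen n b)| <= delta.
  rewrite -transform_moments; apply: le_trans rounding.
  apply: score_dist => // i j i_n jN; by have [] := ans i j i_n.
have goodE b : good N A cf thr n (st b n) = (thr%:~R / A%:R <= ratio b).
  rewrite /good /ratio natrM invfM mulrA ler_pdivlMr ?ltr0n// mulrAC.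
  by rewrite ler_pM2r ?invr_gt0// -[n.+1%:R]/(n.+1%:Z%:~R) -rmorphM/= ler_int.
have feasible_good b :
    (gamma%:E <= prob_fits w (chosen n b) 1)%E -> good N A cf thr n (st b n).
  rewrite prob_fits_fin lee_fin goodE => fits.
  have := prob_le_transform w0 D0 (chosen n b) threshold_ge (ltW delta0).
  by have := ratio_dist b; rewrite ler_norml; lra.
have good_feasible b : good N A cf thr n (st b n) ->
    (((1 - eps) * gamma)%:E <= prob_fits w (chosen n b) (1 + eps))%E.
  rewrite goodE prob_fits_fin lee_fin => ge.
  have := transform_le_prob w0 D0 (chosen n b) threshold_le (ltW delta0).
  have : eps * gamma = 5 * delta by rewrite /delta; field.
  by have := ratio_dist b; rewrite ler_norml mulrBl mul1r; lra.
have dec S : (gamma%:E <= prob_fits w S 1)%E ->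
    good N A cf thr n (st (extend_fun false (fun i => i \in S)) n).
  by move=> fits; apply: feasible_good; rewrite chosen_mem.
(* The empty set has size 0 and is feasible because [gamma <= 1], so the selection never comes out
   empty. *)
have some_good : exists b, good N A cf thr n (st b n).
  exists (fun=> false); apply: feasible_good.
  rewrite /prob_fits (_ : [set t | _]%classic = [set: T]%classic).
    by rewrite probability_setT lee_fin.
  apply/seteqP; split => // t _ /=; rewrite /size_of big1 ?ler01// => i.
  by rewrite inE.
have WL : ((A * n.+1 + 1) ^ N <= Wx x)%N.
  by rewrite /Wx; case: (N) => // N'; rewrite leq_exp2r// leq_add2r leq_mul.
have x_lt := ltn_expl x (ltnSn 1).
have vx i : (v i < 2 ^ x)%N.
  by rewrite (leq_trans (profit_lt v i))// leq_exp2l// leqnSn.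
have [LW Lx Lk L3] := bit_budget (Wx x) k0 nx; rewrite -/(L x) in LW Lx Lk L3.
have xL : (2 ^ x <= 2 ^ L x)%N by rewrite leq_exp2l.
have [||||||||s' [t [run time_le _ [b [gb best out]]]]] :=
  @knapsackP N A D k0 cf thr O n (fun i j i_n _ => let: And4 h _ _ _ := ans i j i_n in h)
    (fun i j i_n _ => let: And4 _ h _ _ := ans i j i_n in h)
    vv (L x) (m x) (2 ^ x)%N
    (fun i j i_n _ => let: And4 _ _ h _ := ans i j i_n in h) _ _ _ _ _ _ some_good
    (input v).
- move=> i i_n; rewrite /vv -[i in extend_fun _ _ i]/(val (Ordinal i_n)).
  by rewrite extend_funE ltnW.
- by rewrite /m (leq_trans (ltnW nx))// leq_addr.
- by rewrite /m (leq_trans WL)// leq_addl.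
- rewrite (leq_ltn_trans WL)// (leq_ltn_trans LW)//; exact: ltn_expl.
- exact: Lk.
- apply: (@leq_trans (2 ^ x * (2 ^ x * 2 ^ x))); last first.
    by rewrite -!expnD leq_exp2l.
  rewrite leq_mul ?leq_exp2l ?(ltnW nx)//.
  apply: (@leq_trans (n.+1 * 2 ^ x)); last by rewrite leq_mul// (leq_trans nx)// ltnW.
  by rewrite mulSn leq_add2r (leq_trans _ x_lt).
- apply: bitlen_input => [|i]; last exact: leq_trans (vx i) xL.
  exact: leq_trans (ltn_trans nx x_lt) xL.
- split; [exact: env_input|by []].
have outE : output n s' = chosen n b.
  apply/setP => i; rewrite !inE out//.
  by case: (b i).
exists s', t; rewrite outE; split => //.
- exact: leq_trans time_le (CK x x0).
- have le : (optimum v w gamma <= profit v (chosen n b))%N.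
    apply/bigmax_leqP => S /dec/best.
    by rewrite !value_profit chosen_mem.
  apply: (@le_trans _ _ (optimum v w gamma)%:R); last by rewrite ler_nat.
  by rewrite ler_piMl//; lra.
- exact: good_feasible.
Qed.
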